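(* Let $3\leq t\leq 6$, let $G$ be a planar graph with maximum degree $\Delta\geq 31-t$, and let $H$ be a subgraph of $G$ with maximum degree at most one. Then any total-$(\Delta+t)$-coloring of $H$ in $G$ can be extended to a total-$(\Delta+t)$-coloring of $G$.
   Context: All graphs are simple. A total-$k$-coloring of a graph is an assignment of colors from $\{1,\dots,k\}$ to its vertices and edges such that adjacent vertices receive different colors, edges sharing an endpoint receive different colors, and no edge receives the same color as either of its endpoints. For a subgraph $H$ of $G$, a total-$k$-coloring $\varphi$ of $H$ is a total-$k$-coloring of $H$ in $G$ if, in addition, $\varphi(u)\neq\varphi(v)$ for all $u,v\in V(H)$ adjacent in $G$. Extending $\varphi$ to $G$ means finding a total-$k$-coloring of $G$ that agrees with $\varphi$ on all vertices and edges of $H$. *)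

(* Defs.v *)
From HB Require Import structures.
From mathcomp Require Import all_boot all_order all_algebra.
From mathcomp Require Import boolp classical_sets reals topology normedtype.
From mathcomp Require Import Rstruct Rstruct_topology.
Set Implicit Arguments. Unset Strict Implicit. Unset Printing Implicit Defensive.
Import Order.TTheory GRing.Theory Num.Theory.

Definition simple_graph (T : finType) (e : rel T) : Prop :=
  symmetric e /\ irreflexive e.

Definition deg (T : finType) (e : rel T) (v : T) : nat := #|[set u | e v u]|.
Definition maxdeg (T : finType) (e : rel T) : nat := \max_(v : T) deg e v.

Definition planar (T : finType) (e : rel T) : Prop :=
  exists (p : T -> (Rdefinitions.R * Rdefinitions.R)%type) (c : T -> T -> Rdefinitions.R -> (Rdefinitions.R * Rdefinitions.R)%type),
    injective p /\
    forall u v, e u v ->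
      [/\ ({within [set x : Rdefinitions.R | (0 <= x <= 1)%R], continuous (c u v)})%classic,
          c u v 0%R = p u /\ c u v 1%R = p v,
          (forall s t : Rdefinitions.R, (0 <= s <= 1)%R -> (0 <= t <= 1)%R ->
              c u v s = c u v t -> s = t),
          (forall (s : Rdefinitions.R) (w : T), (0 < s < 1)%R -> c u v s <> p w) &
          (forall u' v', e u' v' -> ~~ (((u == u') && (v == v')) || ((u == v') && (v == u'))) ->
             forall s t : Rdefinitions.R, (0 < s < 1)%R -> (0 < t < 1)%R ->
               c u v s <> c u' v' t)].

(* Total-k-coloring (colors in {1,..,k}) of the subgraph with vertex set V and
   edge relation E, "in G" where G has edge relation e: vertices of V adjacent
   in G get distinct colors; edges sharing an endpoint get distinct colors;
   an edge's color differs from those of its endpoints. Edge colors are given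
   by the symmetric function ce, read only on edges of E. *)
Definition total_coloring_in (T : finType) (e : rel T) (V : {set T}) (E : rel T)
    (k : nat) (cv : T -> nat) (ce : T -> T -> nat) : Prop :=
  [/\ (forall v, v \in V -> 1 <= cv v <= k),
      (forall u v, E u v -> 1 <= ce u v <= k /\ ce u v = ce v u),
      (forall u v, u \in V -> v \in V -> e u v -> cv u != cv v),
      (forall u v w, E u v -> E u w -> v != w -> ce u v != ce u w) &
      (forall u v, E u v -> ce u v != cv u /\ ce u v != cv v)].

Definition subgraph (T : finType) (e : rel T) (VH : {set T}) (eH : rel T) : Prop :=
  symmetric eH /\ (forall u v, eH u v -> [/\ e u v, u \in VH & v \in VH]).

(* Main.v *)
Require Import Defs.
From HB Require Import structures.
From mathcomp Require Import all_boot all_order all_algebra.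
From mathcomp Require Import zify lra.
From mathcomp Require boolp classical_sets reals prodnormedzmodule topology normedtype derive.
From mathcomp Require Rstruct Rstruct_topology.
Set Implicit Arguments. Unset Strict Implicit. Unset Printing Implicit Defensive.

(* Vertices outside [VH] are coloured greedily: they have at most Delta coloured
   neighbours, no precoloured incident edge, and there are Delta + t > Delta
   colours.  The edges outside H then carry lists with
   |L(uv)| + h(u) + h(v) >= Delta + t - 2 >= 29, where h <= 1 is the degree in H
   and the remaining degrees satisfy d(v) + h(v) <= Delta.

   In a minimal graph not colourable from such lists, d(u) + d(v) >= 29 for every
   edge.  If a set A of vertices of degree at most k <= 5 is such that every
   neighbour b of A has at least k neighbours in A, then the edges at A form a
   bipartite graph that can be coloured last: its remaining lists have size at
   least the degree of b, and Galvin's argument applies to the preferences read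
   off a proper k-edge-colouring of k chosen edges at each b.  Hence there are at
   most k - 1 vertices of degree <= k per vertex of degree >= 24, for each
   k <= 5, so the positive charges d(v) - 6 pay for the negative ones
   (1 + 2 + 3 + 4 = 10 <= 24 - 6), contradicting |E| < 3 |V|.

   The bound |E| < 3 |V| is proved without the Jordan curve theorem.  By
   compactness a drawing is at positive distance from any accidental contact, so
   on a fine enough grid the graph is a minor of the grid: each vertex becomes a
   connected set of cells near the first thirds of its edges, extended along the
   middle thirds.  In a grid Euler's formula and the parity of the incidences
   vertex-edge-face hold by inspection.  Contracting spanning trees of the parts
   and deleting the unused edges leaves at least |E| - |V| + 2 classes of faces,
   the boundary of a class is a nonempty even set of edges of a simple graph,
   hence has at least 3 edges, and every edge lies on at most 2 boundaries. *)

(** * Pigeonhole counting *)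

Lemma card_inj_interval (T : finType) (S : {set T}) (f : T -> nat) (m n : nat) :
  {in S &, injective f} -> (forall x, x \in S -> m <= f x < n) -> #|S| <= n - m.
Proof.
move=> injf fS; rewrite cardE -(size_map f) -(size_iota m (n - m)).
apply: uniq_leq_size.
  by rewrite map_inj_in_uniq ?enum_uniq // => x y; rewrite !mem_enum; apply: injf.
by move=> y /mapP[x]; rewrite mem_enum => /fS fx ->; rewrite mem_iota; lia.
Qed.

Lemma missing_colour (T : finType) (S : {set T}) (c : T -> nat) k :
  #|S| < k -> exists2 g, g < k & {in S, forall x, c x != g}.
Proof.
move=> lt; case: (boolP [exists g : 'I_k, [forall x in S, c x != g]]).
  by case/existsP=> g /forall_inP Hg; exists g.
rewrite negb_exists => /forallP H; suff : k <= #|S| by rewrite leqNgt lt.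
have sub : {subset iota 0 k <= map c (enum S)}.
  move=> g; rewrite mem_iota add0n => /= gk.
  have := H (Ordinal gk); rewrite negb_forall => /existsP[x].
  rewrite negb_imply negbK => /andP[xS /eqP e].
  by apply/mapP; exists x; rewrite ?mem_enum.
by have := uniq_leq_size (iota_uniq 0 k) sub; rewrite size_map size_iota -cardE.
Qed.

(** * List edge colouring of bipartite graphs *)

Section Bipartite.
Variables A B : finType.
Implicit Types (H S M : {set A * B}) (x y : A * B) (ra rb : A * B -> nat).

Definition degl H a := #|[set x in H | x.1 == a]|.
Definition degr H b := #|[set x in H | x.2 == b]|.

Definition meet x y := (x.1 == y.1) || (x.2 == y.2).

(** Smaller ranks are better: [ra] holds the preferences of the left ends, [rb] those of the right
    ends. This orients the line graph. *)
Definition dominates ra rb y x :=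
  ((y.1 == x.1) && (ra y < ra x)) || ((y.2 == x.2) && (rb y < rb x)).

(** Gale and Shapley by induction on [S]: each left vertex proposes its best edge [top]. If no two
    proposals meet on the right they form the matching; otherwise the proposal that the right end
    likes less is deleted. *)
Lemma stable_matching ra rb S :
  {in S &, forall x y, x.1 = y.1 -> ra x = ra y -> x = y} ->
  {in S &, forall x y, x.2 = y.2 -> rb x = rb y -> x = y} ->
  exists M, [/\ M \subset S, {in M &, forall x y, meet x y -> x = y}
    & {in S :\: M, forall x, exists2 y, y \in M & dominates ra rb y x}].
Proof.
elim: {S}_.+1 {-2}S (ltnSn #|S|) => // n IHn S leSn Ha Hb.
pose top x := [forall y in S, (y.1 == x.1) ==> (ra x <= ra y)].
case: (boolP [exists x in S, exists y in S,
   [&& top x, top y, x.2 == y.2 & rb x < rb y]]); last first.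
  move=> notop; exists [set x in S | top x]; split.
  - by apply/subsetP=> x /setIdP[].
  - move=> x y /setIdP[xS tx] /setIdP[yS ty] /orP[/eqP e1|/eqP e2].
      apply: Ha => //; apply/eqP; rewrite eqn_leq.
      move: tx ty => /forall_inP/(_ y yS) + /forall_inP/(_ x xS).
      by rewrite e1 eqxx /= => -> ->.
    apply: Hb => //; case: (ltngtP (rb x) (rb y)) => // lt; case/negP: notop.
      by apply/exists_inP; exists x => //; apply/exists_inP; exists y => //; rewrite tx ty e2 eqxx.
    by apply/exists_inP; exists y => //; apply/exists_inP; exists x => //; rewrite tx ty e2 eqxx.
  - move=> x /setDP[xS]; rewrite inE xS /= => ntx.
    have Px : (x \in S) && (x.1 == x.1) by rewrite xS eqxx.
    case: (@arg_minnP _ x (fun z => (z \in S) && (z.1 == x.1)) ra Px) => z /andP[zS /eqP zx] zmin.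
    have tz : top z.
      apply/forall_inP=> y yS; apply/implyP=> /eqP yz.
      by apply: zmin; rewrite yS yz zx eqxx.
    exists z; first by rewrite inE zS.
    rewrite /dominates zx eqxx /= ltnNge; apply/orP; left; apply: contra ntx => le.
    apply/forall_inP=> y yS; apply/implyP=> /eqP yx.
    by apply: leq_trans le (zmin _ _); rewrite yS yx eqxx.
case/exists_inP=> x xS /exists_inP[y yS /and4P[tx ty /eqP e2 lt]].
have sub : S :\ y \subset S by rewrite subD1set.
have [|||M [MS Mm Md]] := IHn (S :\ y).
- by move: leSn; rewrite (cardsD1 y) yS.
- by move=> u v /(subsetP sub) uS /(subsetP sub); apply: Ha.
- by move=> u v /(subsetP sub) uS /(subsetP sub); apply: Hb.
exists M; split=> //; first exact: subset_trans MS sub.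
move=> z /setDP[zS zM]; case: (eqVneq z y) => [->|zy]; last first.
  by apply: Md; rewrite !inE zM zy.
case: (boolP (x \in M)) => [xM|xM].
  by exists x => //; rewrite /dominates e2 eqxx lt orbT.
have xy : x != y by apply: contraTneq lt => ->; rewrite ltnn.
(* As [x] is best at its left end, [w] can beat it only at the right end, where it then beats [y]
   too. *)
have [|w wM] := Md x; first by rewrite !inE xM xy.
have wS := subsetP sub _ (subsetP MS _ wM).
move=> /orP[/andP[/eqP w1 ltw]|/andP[/eqP w2 ltw]].
  by move/forall_inP: tx => /(_ w wS); rewrite w1 eqxx /= leqNgt ltw.
by exists w => //; rewrite /dominates w2 e2 eqxx (ltn_trans ltw lt) orbT.
Qed.

(* Galvin: the stable matchings are the kernels of the line graph oriented by
   the preferences, and a kernel of each colour class can be coloured in turn. *)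
Lemma galvin (C : finType) (c0 : C) ra rb S (L : A * B -> {set C}) :
  {in S &, forall x y, x.1 = y.1 -> ra x = ra y -> x = y} ->
  {in S &, forall x y, x.2 = y.2 -> rb x = rb y -> x = y} ->
  {in S, forall x, #|[set y in S | dominates ra rb y x]| < #|L x|} ->
  exists c : A * B -> C, {in S, forall x, c x \in L x} /\
    {in S &, forall x y, meet x y -> c x = c y -> x = y}.
Proof.
elim: {S}_.+1 {-2}S (ltnSn #|S|) L => // n IHn S leSn L Ha Hb HL.
have [->|[x xS]] := set_0Vmem S.
  by exists (fun=> c0); split=> x; rewrite inE.
have /card_gt0P[g gx] := leq_ltn_trans (leq0n _) (HL x xS).
pose Sg := [set y in S | g \in L y].
have sSg : Sg \subset S by apply/subsetP=> y /setIdP[].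
have [||M [MS Mm Md]] := @stable_matching ra rb Sg.
- by move=> u v /(subsetP sSg) uS /(subsetP sSg); apply: Ha.
- by move=> u v /(subsetP sSg) uS /(subsetP sSg); apply: Hb.
have [z zM] : exists z, z \in M.
  case: (boolP (x \in M)) => xM; first by exists x.
  by have [|y yM _] := Md x; [rewrite !inE xM xS | exists y].
have sMS := subset_trans MS sSg.
have sD : S :\: M \subset S by rewrite subsetDl.
have [||||c [cL cP]] := IHn (S :\: M) _ (fun y => L y :\ g).
- apply: leq_trans (leSn : _ <= n); apply: proper_card; apply/properP; split=> //.
  by exists z; [exact: (subsetP sMS) | rewrite inE zM].
- by move=> u v /(subsetP sD) uS /(subsetP sD); apply: Ha.
- by move=> u v /(subsetP sD) uS /(subsetP sD); apply: Hb.
- move=> y /setDP[yS yM]; have := HL y yS; rewrite (cardsD1 g (L y)).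
  case: (boolP (g \in L y)) => gy; last first.
    apply: leq_trans; rewrite ltnS; apply: subset_leq_card; apply/subsetP=> w.
    by rewrite !inE => /andP[/andP[_ ->] ->].
  (* When [y] loses the colour [g], it also loses a dominating edge [m], coloured [g]; the strict
     inequality survives. *)
  have [|m mM mD] := Md y; first by rewrite !inE yM yS.
  rewrite add1n ltnS; apply: leq_trans; apply: proper_card; apply/properP; split.
    by apply/subsetP=> w; rewrite !inE => /andP[/andP[_ ->] ->].
  by exists m; rewrite !inE ?mM // (subsetP sMS).
exists (fun y => if y \in M then g else c y); split.
  move=> y yS; case: ifPn => yM; first by have := subsetP MS _ yM; rewrite inE => /andP[].
  by have := cL y; rewrite !inE yM yS => /(_ isT) /andP[].
have cg y : y \in S -> y \notin M -> c y != g.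
  by move=> yS yM; have := cL y; rewrite !inE yM yS => /(_ isT) /andP[].
move=> u v uS vS muv; case: ifPn => uM; case: ifPn => vM.
- by move=> _; apply: Mm.
- by move=> E; have := cg v vS vM; rewrite -E eqxx.
- by move=> E; have := cg u uS uM; rewrite E eqxx.
- by apply: cP; rewrite // inE ?uM ?vM.
Qed.

(* Kempe chains: [X] is the set of left vertices of the chain leaving [x0.1]. *)
Lemma koenig_edge_colouring k H :
  (forall a, degl H a <= k) -> (forall b, degr H b <= k) ->
  exists c : A * B -> nat, {in H, forall x, c x < k} /\
    {in H &, forall x y, meet x y -> c x = c y -> x = y}.
Proof.
elim: {H}_.+1 {-2}H (ltnSn #|H|) => // n IHn H leHn Ha Hb.
have [->|[x0 x0H]] := set_0Vmem H.
  by exists (fun=> 0); split=> x; rewrite inE.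
pose H' := H :\ x0.
have sub : H' \subset H by rewrite subD1set.
have [|||c [ck cP]] := IHn H'.
- by move: leHn; rewrite (cardsD1 x0) x0H.
- move=> a; apply: leq_trans (Ha a); apply: subset_leq_card; apply/subsetP=> z.
  by rewrite !inE => /andP[/andP[_ ->] ->].
- move=> b; apply: leq_trans (Hb b); apply: subset_leq_card; apply/subsetP=> z.
  by rewrite !inE => /andP[/andP[_ ->] ->].
(* [al] is free at the left end of the uncoloured edge [x0], [be] at its right end. *)
have [|al alk mal] := @missing_colour _ [set x in H' | x.1 == x0.1] c k.
  apply: leq_trans (Ha x0.1); apply: proper_card; apply/properP; split.
    by apply/subsetP=> z; rewrite !inE => /andP[/andP[_ ->] ->].
  by exists x0; rewrite !inE ?x0H ?eqxx.
have [|be bek mbe] := @missing_colour _ [set x in H' | x.2 == x0.2] c k.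
  apply: leq_trans (Hb x0.2); apply: proper_card; apply/properP; split.
    by apply/subsetP=> z; rewrite !inE => /andP[/andP[_ ->] ->].
  by exists x0; rewrite !inE ?x0H ?eqxx.
(* The chain leaves a left vertex by a [be]-edge and comes back by an [al]-edge, since [al] is
   absent at [x0.1]. *)
pose step a a' := [exists b, [&& (a, b) \in H', (a', b) \in H',
                                c (a, b) == be & c (a', b) == al]].
pose X := connect step x0.1.
pose sw g := if g == al then be else if g == be then al else g.
have sw_inj : injective sw.
  by move=> g1 g2; rewrite /sw; do !case: eqP => //; congruence.
pose c' x := if X x.1 then sw (c x) else c x.
(* The [al]-edge at a chain vertex is the one by which the chain arrived, so a [be]-edge of the
   chain precedes it. *)
have alX a b : X a -> (a, b) \in H' -> c (a, b) = al ->
    exists a', [/\ X a', (a', b) \in H' & c (a', b) = be].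
  move=> /connectP[p]; case/lastP: p => [_ /= ->|p a' pth ea] abH e.
    by have := mal (x0.1, b); rewrite inE abH e !eqxx => /(_ isT).
  move: pth ea; rewrite rcons_path last_rcons => /andP[pth].
  case/existsP=> b' /and4P[H1 H2 /eqP c1 /eqP c2] ea; subst a'.
  have [eb] : (a, b') = (a, b) by apply: cP; rewrite ?c2 ?e // /meet /= eqxx.
  subst b'; exists (last x0.1 p); split=> //; apply/connectP; by exists p.
have c'P : {in H' &, forall x y, meet x y -> c' x = c' y -> x = y}.
  have key a a' b : (a, b) \in H' -> (a', b) \in H' -> X a -> ~~ X a' ->
      sw (c (a, b)) <> c (a', b).
    move=> h1 h2 Xa Xa'; rewrite /sw; case: eqP => [e|_].
      move=> e'; have [a'' [Xa'' h3 e3]] := alX _ _ Xa h1 e.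
      have [E] : (a'', b) = (a', b) by apply: cP; rewrite ?e3 // /meet /= eqxx orbT.
      by move: Xa'; rewrite -E Xa''.
    case: eqP => [e|_] e'.
      case/negP: Xa'; apply: connect_trans Xa _; apply: connect1.
      by apply/existsP; exists b; rewrite h1 h2 e -e' !eqxx.
    have [E] : (a, b) = (a', b) by apply: cP; rewrite // /meet /= eqxx orbT.
    by move: Xa'; rewrite -E Xa.
  move=> [a b] [a' b'] h h' m; rewrite /c' /=.
  case: ifP => Xa; case: ifP => Xa'.
  - by move=> /sw_inj; apply: cP.
  - case/orP: m => /= /eqP e; subst; first by rewrite Xa in Xa'.
    by move=> E; case: (key _ _ _ h h' Xa (negbT Xa')).
  - case/orP: m => /= /eqP e; subst; first by rewrite Xa in Xa'.
    by move=> E; case: (key _ _ _ h' h Xa' (negbT Xa)).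
  - by apply: cP.
(* After the swap [be] is free at both ends of [x0]: a chain arriving at [x0.2] along [al] would
   need a [be]-edge there. *)
have x0new y : y \in H' -> meet x0 y -> c' y != be.
  case: y => a b abH; apply: contraTN => /eqP; rewrite /c' /=.
  case: ifP => Xa; last first.
    move=> e; apply/negP; case/orP=> /= /eqP E; first by rewrite -E /X connect0 in Xa.
    by have := mbe (a, b); rewrite inE abH E e !eqxx => /(_ isT).
  have swE g : sw g = be -> g = al by rewrite /sw; do !case: eqP => //; congruence.
  move=> /swE e; apply/negP; case/orP=> /= /eqP E.
    by have := mal (a, b); rewrite inE abH E e !eqxx => /(_ isT).
  have [a' [_ h e']] := alX _ _ Xa abH e.
  by have := mbe (a', b); rewrite inE h E e' !eqxx => /(_ isT).
exists (fun x => if x == x0 then be else c' x); split.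
  move=> x xH; case: eqVneq => // xx0; have xH' : x \in H' by rewrite !inE xx0.
  by rewrite /c' /sw; do !case: ifP => // _; apply: ck.
move=> x y xH yH; case: (eqVneq x x0) => [->|xx0]; case: (eqVneq y x0) => [-> //|yx0] m e.
- by have := x0new y; rewrite !inE yx0 yH -e eqxx => /(_ isT m).
- have m' : meet x0 x by rewrite /meet [x0.1 == _]eq_sym [x0.2 == _]eq_sym.
  by have := x0new x; rewrite !inE xx0 xH e eqxx => /(_ isT m').
- by apply: c'P; rewrite // !inE ?xx0 ?yx0.
Qed.

Lemma degl_max H k : {in H, forall x, degl H x.1 <= k} -> forall a, degl H a <= k.
Proof.
move=> Hk a; rewrite /degl; have [->|[x]] := set_0Vmem [set x in H | x.1 == a].
  by rewrite cards0.
by rewrite inE => /andP[xH /eqP <-]; apply: Hk.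
Qed.

Lemma right_regular_subset H k : {in H, forall x, k <= degr H x.2} ->
  exists2 H0 : {set A * B}, H0 \subset H &
    (forall b, degr H0 b <= k) /\ {in H, forall x, degr H0 x.2 = k}.
Proof.
move=> Hk; pose D b := [set x in H | x.2 == b].
pose H0 := [set x in H | index x (enum (D x.2)) < k].
have H0E b : degr H0 b = minn k (degr H b).
  have -> : degr H0 b = #|[set x in take k (enum (D b))]|.
    apply: eq_card => x; rewrite !inE; case: (boolP (x \in D b)) => [xD|xD].
      by move: (xD); rewrite inE in_take ?mem_enum // => /andP[-> /eqP <-]; rewrite eqxx andbT.
    have -> : x \in take k (enum (D b)) = false.
      by apply: contraNF xD => /mem_take; rewrite mem_enum.
    apply/negP=> /andP[/andP[xH _] xb]; case/negP: xD; by rewrite inE xH xb.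
  by rewrite cardsE (card_uniqP _) ?take_uniq ?enum_uniq // size_take_min -cardE.
exists H0; first by apply/subsetP=> x /setIdP[].
split=> [b|x xH]; first by rewrite H0E geq_minl.
by rewrite H0E; apply/minn_idPl; apply: Hk.
Qed.

(** Galvin's theorem is applied to a mixed ranking. Left ends prefer the [k] chosen edges, by
    increasing colour, to all others; right ends prefer the unchosen edges, and then the chosen ones
    by decreasing colour. *)
Lemma bipartite_list_colouring (C : finType) (c0 : C) k H (L : A * B -> {set C}) :
  {in H, forall x, degl H x.1 <= k <= degr H x.2} ->
  {in H, forall x, degr H x.2 <= #|L x|} ->
  exists c : A * B -> C, {in H, forall x, c x \in L x} /\
    {in H &, forall x y, meet x y -> c x = c y -> x = y}.
Proof.
move=> Hk HL.
have Hl : {in H, forall x, degl H x.1 <= k} by move=> x /Hk/andP[].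
have [H0 sH0 [H0r H0k]] : exists2 H0 : {set A * B}, H0 \subset H &
    (forall b, degr H0 b <= k) /\ {in H, forall x, degr H0 x.2 = k}.
  by apply: right_regular_subset => x /Hk/andP[].
have [|c [ck cP]] := @koenig_edge_colouring k H0 _ H0r.
  move=> a; apply: leq_trans (degl_max Hl a); apply: subset_leq_card.
  by apply/subsetP=> x; rewrite !inE => /andP[/(subsetP sH0) -> ->].
(* An edge of [H0] of colour [j] has at most [j] better edges at its left end and
   [degr H b - 1 - j] better ones at its right end [b]. *)
pose N := #|{: A * B}|.
have rankN x : enum_rank x < N by exact: ltn_ord.
pose ra x := if x \in H0 then c x else k + enum_rank x.
pose rb x := if x \in H0 then N + (k - c x) else enum_rank x.
apply: (@galvin _ c0 ra rb).
- move=> x y xH yH e1; rewrite /ra; case: ifP => x0; case: ifP => y0.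
  + by apply: cP => //; rewrite /meet e1 eqxx.
  + by have := ck x x0; lia.
  + by have := ck y y0; lia.
  + by move=> /eqP; rewrite eqn_add2l => /eqP/val_inj/enum_rank_inj.
- move=> x y xH yH e2; rewrite /rb; case: ifP => x0; case: ifP => y0.
  + move=> e; apply: cP => //; first by rewrite /meet e2 eqxx orbT.
    by have := ck x x0; have := ck y y0; lia.
  + by have := rankN y; lia.
  + by have := rankN x; lia.
  + by move=> /val_inj/enum_rank_inj.
move=> x xH; apply: leq_trans (HL x xH).
have bH0 : #|[set y in H :\: H0 | y.2 == x.2]| + k = degr H x.2.
  rewrite -(H0k x xH) /degr -(cardsID H0 [set y in H | y.2 == x.2]) addnC; congr (_ + _).
    apply: eq_card => y; rewrite !inE; case: (boolP (y \in H0)) => [yH0|]; rewrite ?andbF //.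
    by rewrite (subsetP sH0) // andbT.
  by apply: eq_card => y; rewrite !inE; case: (y \in H0); rewrite ?andbF ?andbT.
pose D1 := [set y in H | (y.1 == x.1) && (ra y < ra x)].
pose D2 := [set y in H | (y.2 == x.2) && (rb y < rb x)].
have sD : [set y in H | dominates ra rb y x] \subset D1 :|: D2.
  by apply/subsetP=> y; rewrite !inE => /andP[-> ].
apply: leq_ltn_trans (subset_leq_card sD) _; apply: leq_ltn_trans (leq_card_setU _ _) _.
case: (boolP (x \in H0)) => x0.
- have cx := ck x x0.
  have D1c y : y \in D1 -> [/\ y \in H0, y.1 = x.1 & c y < c x].
    rewrite !inE /ra x0 => /and3P[_ /eqP y1]; case: ifP => // _.
    by rewrite ltnNge (leq_trans (ltnW cx)) ?leq_addr.
  have : #|D1| <= c x - 0.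
    apply: (@card_inj_interval _ _ c) => [y z /D1c[y0 y1 _] /D1c[z0 z1 _]|y /D1c[]//].
    by apply: cP => //; rewrite /meet y1 z1 eqxx.
  have : #|D2| <= #|[set y in H :\: H0 | y.2 == x.2]| + (k - (c x).+1).
    pose D3 := [set y in H0 | (y.2 == x.2) && (c x < c y)].
    apply: (@leq_trans (#|[set y in H :\: H0 | y.2 == x.2]| + #|D3|)).
      apply: leq_trans (leq_card_setU _ _); apply: subset_leq_card; apply/subsetP=> y.
      rewrite !inE /rb x0; case: ifP => y0 /and3P[-> -> lt] //=.
      by have := ck y y0; lia.
    rewrite leq_add2l; apply: (@card_inj_interval _ _ c) => [y z|y]; rewrite !inE.
      case/and3P=> y0 /eqP y2 _ /and3P[z0 /eqP z2 _]; apply: cP => //.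
      by rewrite /meet y2 z2 eqxx orbT.
    by case/and3P=> y0 _ ->; have := ck y y0.
  by lia.
(* An edge outside [H0] has at most [k - 1] rivals at its left end, whose degree is at most [k], and
   at its right end only other edges outside [H0]. *)
- have : #|D1| < k.
    have := Hl x xH; apply: leq_trans; apply: proper_card; apply/properP; split.
      by apply/subsetP=> y; rewrite !inE => /and3P[-> ->].
    by exists x; rewrite !inE ?xH ?eqxx // ltnn !andbF.
  have : #|D2| < #|[set y in H :\: H0 | y.2 == x.2]|.
    apply: proper_card; apply/properP; split.
      apply/subsetP=> y; rewrite !inE /rb (negPf x0); case: ifP => y0 /and3P[-> -> lt] //=.
      by have := rankN x; lia.
    by exists x; rewrite !inE ?xH ?x0 ?eqxx // ltnn !andbF.
  by lia.
Qed.
End Bipartite.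

(** * List edge colouring of sparse graphs *)

Section ListColouring.
Variables (T C : finType).
Implicit Types (g : rel T) (L : T -> T -> {set C}).

Definition list_edge_colouring g L (f : T -> T -> C) :=
  [/\ forall u v, g u v -> f u v \in L u v,
      forall u v, g u v -> f u v = f v u &
      forall u v w, g u v -> g u w -> v != w -> f u v != f u w].

Lemma deglE (H : {set T * T}) a : degl H a = #|[set w | (a, w) \in H]|.
Proof.
rewrite /degl -[RHS](@card_imset _ _ (pair a)); last by move=> x y [].
apply: eq_card => -[x y]; rewrite !inE /=.
apply/andP/imsetP => [[xyH /eqP e]|[w + [-> ->]]].
  by exists y; rewrite ?inE -e.
by rewrite inE => ->.
Qed.

Lemma degrE (H : {set T * T}) b : degr H b = #|[set w | (w, b) \in H]|.
Proof.
rewrite /degr -[RHS](@card_imset _ _ (pair^~ b)); last by move=> x y [].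
apply: eq_card => -[x y]; rewrite !inE /=.
apply/andP/imsetP => [[xyH /eqP e]|[w + [-> ->]]].
  by exists x; rewrite ?inE -e.
by rewrite inE => ->.
Qed.

(** The edges of [H], oriented out of [A] and hence bipartite, are coloured last. Deleting from a
    list the colours used at both ends leaves at least [degr H] colours at the right end. *)
Lemma extend_list_colouring g L (H : {set T * T}) (A : {set T}) k f :
  symmetric g -> (forall u v, L u v = L v u) ->
  {in H, forall x, [/\ g x.1 x.2, x.1 \in A & x.2 \notin A]} ->
  {in H, forall x, degl H x.1 <= k <= degr H x.2} ->
  {in H, forall x, deg g x.1 + deg g x.2 <= #|L x.1 x.2| + degl H x.1} ->
  list_edge_colouring (fun u v => [&& g u v, (u, v) \notin H & (v, u) \notin H]) L f ->
  exists f', list_edge_colouring g L f'.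
Proof.
move=> gS LS HA Hk HL; set g' := (fun u v => _) => -[fL fS fP].
have [H0|[x0 x0H]] := set_0Vmem H.
  have gg' u v : g u v -> g' u v by rewrite /g' H0 !inE => ->.
  exists f; split=> [u v /gg'|u v /gg'|u v w /gg' ? /gg']; [exact: fL|exact: fS|exact: fP].
pose used u := [set f u w | w in [set w | g' u w]].
have g'l a : deg g' a + degl H a <= deg g a.
  rewrite deglE /deg -cardsUI [X in _ + X]eq_card0 ?addn0.
    apply: subset_leq_card; apply/subsetP=> w; rewrite !inE.
    by case/orP=> [/and3P[]|/HA[]].
  by move=> w; rewrite !inE /g'; case: (_ \in H); rewrite ?andbF.
have g'r b : deg g' b + degr H b <= deg g b.
  rewrite degrE /deg -cardsUI [X in _ + X]eq_card0 ?addn0.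
    apply: subset_leq_card; apply/subsetP=> w; rewrite !inE.
    by case/orP=> [/and3P[]|/HA[]] //=; rewrite gS.
  by move=> w; rewrite !inE /g'; case: ((w, b) \in H); rewrite ?andbF.
have usedle u : #|used u| <= deg g' u by apply: leq_imset_card.
have [||c [cL cP]] := @bipartite_list_colouring _ _ C (f x0.1 x0.2) k H
    (fun x => L x.1 x.2 :\: (used x.1 :|: used x.2)) => //.
  move=> x xH; have := cardsID (used x.1 :|: used x.2) (L x.1 x.2).
  have : #|L x.1 x.2 :&: (used x.1 :|: used x.2)| <= #|used x.1| + #|used x.2|.
    apply: leq_trans (leq_card_setU _ _); apply: subset_leq_card; exact: subsetIr.
  have := usedle x.1; have := usedle x.2; have := g'l x.1; have := g'r x.2.
  by have := HL x xH; lia.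
have HN u v : (u, v) \in H -> (v, u) \in H -> False.
  by move=> /HA[_ /= uA _] /HA[_ _ /=]; rewrite uA.
have cL' x : x \in H -> [/\ c x \in L x.1 x.2, c x \notin used x.1 & c x \notin used x.2].
  by move=> /cL; rewrite !inE negb_or => /andP[/andP[]].
have g'f u v : g' u v -> f u v \in used u.
  by move=> h; apply/imsetP; exists v; rewrite ?inE.
exists (fun u v => if (u, v) \in H then c (u, v) else if (v, u) \in H then c (v, u) else f u v).
split.
- move=> u v guv; case: ifP => [/cL'[] //|h1]; case: ifP => [/cL'[] //|h2]; first by rewrite LS.
  by apply: fL; rewrite /g' guv h1 h2.
- move=> u v guv; case: ifP => h1; case: ifP => h2 //; first by case: (HN _ _ h1 h2).
  by apply: fS; rewrite /g' guv h1 h2.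
move=> u v w guv guw vw.
have neq x y : c x \notin used u -> f u y \in used u -> c x != f u y.
  by move=> h1 h2; apply: contraNneq h1 => ->.
case: ifP => h1; [|case: ifP => h2]; (case: ifP => h3; [|case: ifP => h4]).
- by apply: contraNneq vw => /cP; rewrite /meet eqxx => /(_ h1 h3 isT)[->].
- by have [_ /= uA _] := HA _ h1; have [_ _ /=] := HA _ h4; rewrite uA.
- by have [_ h _] := cL' _ h1; apply: neq => //; apply: g'f; rewrite /g' guw h3 h4.
- by have [_ /= uA _] := HA _ h3; have [_ _ /=] := HA _ h2; rewrite uA.
- by apply: contraNneq vw => /cP; rewrite /meet eqxx orbT => /(_ h2 h4 isT)[->].
- by have [_ _ h] := cL' _ h2; apply: neq => //; apply: g'f; rewrite /g' guw h3 h4.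
- have [_ h _] := cL' _ h3; rewrite eq_sym.
  by apply: neq => //; apply: g'f; rewrite /g' guv h1 h2.
- have [_ _ h] := cL' _ h4; rewrite eq_sym.
  by apply: neq => //; apply: g'f; rewrite /g' guv h1 h2.
by apply: fP; rewrite // /g' ?guv ?guw ?h1 ?h2 ?h3 ?h4.
Qed.
End ListColouring.

Lemma deg_gt0 (T : finType) (g : rel T) u v : g u v -> 0 < deg g u.
Proof. by move=> guv; apply/card_gt0P; exists v; rewrite inE. Qed.

(** The degree sum is twice the number of edges, so this reads |E| < 3 |V| after discarding isolated
    vertices. Quantifying over subgraphs makes it available for a minimal counterexample. *)
Definition sparse (T : finType) (e : rel T) := forall g : rel T,
  symmetric g -> subrel g e -> (exists u v, g u v) ->
  \sum_v deg g v < 6 * #|[set v | 0 < deg g v]|.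

(* Each small vertex is charged to a neighbour that still sees fewer than [k] of
   the remaining ones, so no vertex is charged more than [k.-1] times. *)
Lemma card_le_neighbours (T : finType) (g : rel T) k (A0 : {set T}) :
  (forall A : {set T}, A \subset A0 -> A != set0 ->
     exists b, 0 < #|[set a in A | g a b]| < k) ->
  forall A : {set T}, A \subset A0 ->
    #|A| <= k.-1 * #|[set b | [exists a in A, g a b]]|.
Proof.
move=> HA A; elim: {A}_.+1 {-2}A (ltnSn #|A|) => // n IHn A leAn sA.
have [->|A0'] := eqVneq A set0; first by rewrite cards0.
have [b /andP[b0 bk]] := HA A sA A0'.
pose Ab := [set a in A | g a b].
have cA : #|A :\: Ab| + #|Ab| = #|A|.
  rewrite -(cardsID Ab A) addnC; congr (_ + _); apply: eq_card => a.
  by rewrite !inE; case: (a \in A).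
have := IHn (A :\: Ab); rewrite (subset_trans (subsetDl _ _) sA) => /(_ _ isT).
rewrite (cardsD1 b [set b | [exists a in A, g a b]]).
have -> : b \in [set b | [exists a in A, g a b]].
  rewrite inE; case/card_gt0P: b0 => a; rewrite inE => /andP[aA ab].
  by apply/exists_inP; exists a.
have : #|[set b | [exists a in A :\: Ab, g a b]]| <=
       #|[set b | [exists a in A, g a b]] :\ b|.
  apply: subset_leq_card; apply/subsetP=> c; rewrite !inE => /exists_inP[a].
  rewrite !inE => /andP[aAb aA] ac; apply/andP; split.
    by apply: contraNneq aAb => <-; rewrite aA.
  by apply/exists_inP; exists a.
rewrite -/Ab in b0 bk; nia.
Qed.

(** Induction on the edges of a subgraph [g]: a light edge or a crowded set of small vertices is
    reducible, and discharging shows that one of them occurs. In the application [h] is the degree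
    in the precoloured matching. *)
Lemma sparse_list_edge_colouring (T C : finType) (c0 : C) (e : rel T) (h : T -> nat)
    (L : T -> T -> {set C}) D :
  symmetric e -> irreflexive e -> sparse e -> 29 <= D ->
  (forall v, h v <= 1) -> (forall v, deg e v + h v < D) ->
  (forall u v, L u v = L v u) ->
  (forall u v, e u v -> D <= #|L u v| + h u + h v) ->
  exists f, list_edge_colouring e L f.
Proof.
move=> eS eI eSp D29 h1 hD LS LD.
suff main g : symmetric g -> subrel g e -> exists f, list_edge_colouring g L f.
  exact: main.
elim: {g}_.+1 {-2}g (ltnSn (\sum_v deg g v)) => // n IHn g len gS ge.
case: (boolP [exists u, exists v, g u v]); last first.
  move=> no; have nog u v : g u v -> False.
    by move=> guv; case/negP: no; apply/existsP; exists u; apply/existsP; exists v.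
  by exists (fun _ _ => c0); split=> [u v /nog|u v /nog|u v w /nog].
move=> /existsP[u0 /existsP[v0 g0]].
have degge v : deg g v <= deg e v.
  by apply: subset_leq_card; apply/subsetP=> w; rewrite !inE; apply: ge.
have reduce (H : {set T * T}) (A : {set T}) k : H != set0 ->
    {in H, forall x, [/\ g x.1 x.2, x.1 \in A & x.2 \notin A]} ->
    {in H, forall x, degl H x.1 <= k <= degr H x.2} ->
    {in H, forall x, deg g x.1 + deg g x.2 <= #|L x.1 x.2| + degl H x.1} ->
    exists f, list_edge_colouring g L f.
  move=> /set0Pn[x xH] HA Hk HL.
  have [||//|f Hf] := IHn (fun u v => [&& g u v, (u, v) \notin H & (v, u) \notin H]).
  - apply: leq_trans (_ : \sum_v deg g v <= n); last by [].
    rewrite (bigD1 x.1) //= [X in _ < X](bigD1 x.1) //= -addSn; apply: leq_add.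
      have [gx _ _] := HA x xH; apply: proper_card; apply/properP; split.
        by apply/subsetP=> w; rewrite !inE => /and3P[].
      by exists x.2; rewrite !inE gx // -surjective_pairing xH.
    apply: leq_sum => v _; apply: subset_leq_card.
    by apply/subsetP=> w; rewrite !inE => /and3P[].
  - by move=> u v; rewrite gS; case: (_ \in H); case: (_ \in H).
  - by move=> u v /and3P[/ge].
  exact: extend_list_colouring gS LS HA Hk HL Hf.
(* First reducible configuration: an edge meeting fewer edges than its list has colours. *)
case: (boolP [exists u, exists v, g u v && (deg g u + deg g v <= #|L u v|.+1)]).
  move=> /existsP[u /existsP[v /andP[guv duv]]].
  have d1 : degl [set (u, v)] u = 1.
    rewrite deglE (_ : [set _ | _] = [set v]) ?cards1 //.
    by apply/setP=> w; rewrite !inE xpair_eqE eqxx.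
  have d2 : degr [set (u, v)] v = 1.
    rewrite degrE (_ : [set _ | _] = [set u]) ?cards1 //.
    by apply/setP=> w; rewrite !inE xpair_eqE eqxx andbT.
  apply: (@reduce [set (u, v)] [set u] 1).
  - by apply/set0Pn; exists (u, v); rewrite inE.
  - move=> _ /set1P -> /=; rewrite !inE eqxx; split=> //.
    by apply: contraTneq guv => ->; apply/negP => /ge; rewrite eI.
  - by move=> _ /set1P -> /=; rewrite d1 d2.
  - by move=> _ /set1P -> /=; rewrite d1; lia.
move=> nolight; have heavy u v : g u v -> D <= deg g u + deg g v.
  move=> guv; move: nolight; rewrite negb_exists => /forallP/(_ u).
  rewrite negb_exists => /forallP/(_ v); rewrite guv /=.
  by have := LD u v (ge _ _ guv); have := h1 u; have := h1 v; lia.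
pose Sm k := [set v | 0 < deg g v <= k].
pose Big := [set v | 24 <= deg g v].
case: (boolP [exists k : 'I_6, exists A : {set T}, [&& A \subset Sm k, A != set0 &
   [forall b, (0 < #|[set a in A | g a b]|) ==> (k <= #|[set a in A | g a b]|)]]]).
  case/existsP=> -[k k6] /existsP[A /and3P[/= /subsetP sA /set0Pn[a0 a0A] /forallP kA]].
  pose H := [set x : T * T | (x.1 \in A) && g x.1 x.2].
  have dH a : a \in A -> degl H a = deg g a.
    by move=> aA; rewrite deglE; apply: eq_card => w; rewrite !inE /= aA.
  have smA a : a \in A -> 0 < deg g a <= k by move=> /sA; rewrite inE.
  apply: (@reduce H A k).
  - have /andP[/card_gt0P[b]] := smA _ a0A; rewrite inE => gab _.
    by apply/set0Pn; exists (a0, b); rewrite inE /= a0A.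
  - move=> x; rewrite inE => /andP[xA gx]; split=> //; apply/negP=> xA2.
    by have := heavy _ _ gx; have := smA _ xA; have := smA _ xA2; lia.
  - move=> x; rewrite inE => /andP[xA gx]; rewrite dH //.
    have /andP[_ ->] /= := smA _ xA; have := kA x.2; rewrite degrE.
    have -> : [set w | (w, x.2) \in H] = [set a in A | g a x.2].
      by apply/setP=> w; rewrite !inE.
    by move=> /implyP; apply; apply/card_gt0P; exists x.1; rewrite inE xA.
  (* What remains is that the list is as large as the degree of [x.2]. The strict inequality in [hD]
     compensates for [h x.1], and [h x.2] cancels. *)
  - move=> x; rewrite inE => /andP[xA gx]; rewrite dH // [leqRHS]addnC leq_add2l.
    have := LD _ _ (ge _ _ gx); have := hD x.2; have := degge x.2.
    by have := h1 x.1; lia.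
rewrite negb_exists => /forallP noconf.
have SmBig (k : 'I_6) : #|Sm k| <= k.-1 * #|Big|.
  apply: leq_trans (@card_le_neighbours T g k (Sm k) _ (Sm k) (subxx _)) _.
    move=> A sA A0; have := noconf k; rewrite negb_exists => /forallP/(_ A).
    rewrite sA A0 /= negb_forall => /existsP[b]; rewrite negb_imply -ltnNge => bA.
    by exists b.
  rewrite leq_mul2l; apply/orP; right; apply: subset_leq_card; apply/subsetP=> b.
  rewrite !inE => /exists_inP[a]; rewrite inE => aS gab.
  (* 29 - 5 = 24: neighbours of vertices of degree at most 5 are in [Big]. *)
  by have := heavy _ _ gab; have := ltn_ord k; lia.
have /(_ _ gS ge) := eSp; move=> /(_ (ex_intro _ u0 (ex_intro _ v0 g0))).
(* A vertex of degree d between 1 and 5 lies in exactly 6 - d of the sets [Sm 1], ..., [Sm 5], which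
   is its deficit; by [SmBig] these sets have together at most (0 + 1 + 2 + 3 + 4) [#|Big|]
   elements. *)
suff : 6 * #|[set v | 0 < deg g v]| + 10 * #|Big| <=
       \sum_v deg g v + (#|Sm 1| + #|Sm 2| + #|Sm 3| + #|Sm 4| + #|Sm 5|).
  have := SmBig (inord 1); have := SmBig (inord 2); have := SmBig (inord 3).
  have := SmBig (inord 4); have := SmBig (inord 5); rewrite !inordK //; lia.
have cardsum (P : pred T) : #|[set v | P v]| = \sum_v P v.
  by rewrite -sum1dep_card big_mkcond; apply: eq_bigr => v _; case: (P v).
rewrite /Sm /Big !cardsum !big_distrr /= -!big_split /=.
apply: leq_sum => v _; case: (deg g v) => [|[|[|[|[|[|d]]]]]] //=; lia.
Qed.

(** * Extending total colourings of sparse graphs *)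

Lemma deg_le_maxdeg (T : finType) (e : rel T) v : deg e v <= maxdeg e.
Proof. exact: leq_bigmax. Qed.

Lemma extend_vertex_colouring (T : finType) (e : rel T) (V : {set T}) k (c : T -> nat) :
  symmetric e -> irreflexive e -> maxdeg e < k ->
  (forall v, v \in V -> 1 <= c v <= k) ->
  (forall u v, u \in V -> v \in V -> e u v -> c u != c v) ->
  exists c', [/\ forall v, 1 <= c' v <= k, forall u v, e u v -> c' u != c' v
    & forall v, v \in V -> c' v = c v].
Proof.
move=> eS eI ek ck cP.
suff [c' [c'k c'P c'V]] : exists c' : T -> nat, [/\ forall v, v \in enum T -> 1 <= c' v <= k,
    forall u v, u \in enum T -> v \in enum T -> e u v -> c' u != c' v
    & forall v, v \in V -> c' v = c v].
  by exists c'; split=> // [v|u v]; [apply: c'k|apply: c'P]; rewrite mem_enum.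
suff [c' [c'k c'P c'V]] : exists c' : T -> nat,
    [/\ forall v, (v \in V) || (v \in enum T) -> 1 <= c' v <= k,
    forall u v, (u \in V) || (u \in enum T) -> (v \in V) || (v \in enum T) -> e u v -> c' u != c' v
    & forall v, v \in V -> c' v = c v].
  by exists c'; split=> // [v h|u v h1 h2]; [apply: c'k|apply: c'P]; rewrite ?h ?h1 ?h2 orbT.
elim: (enum T) => [|v s [c' [c'k c'P c'V]]].
  by exists c; split=> [v|u v|//]; rewrite !in_nil !orbF; [apply: ck|apply: cP].
case: (boolP ((v \in V) || (v \in s))) => vs.
  have E u : (u \in V) || (u \in v :: s) = (u \in V) || (u \in s).
    by rewrite inE; case: (eqVneq u v) => [->|//]; rewrite vs orbT.
  by exists c'; split=> // [u|u w]; rewrite !E; [apply: c'k|apply: c'P].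
(* [missing_colour] counts from 0 and the colours from 1, hence the predecessor here and [g.+1]
   below. *)
have [g gk gP] := @missing_colour _ [set w | e v w] (fun w => (c' w).-1) k
  (leq_ltn_trans (deg_le_maxdeg e v) ek).
have vV : v \notin V by apply: contra vs => ->.
have gP' w : e v w -> (w \in V) || (w \in s) -> c' w != g.+1.
  move=> vw ws; have := gP w; rewrite inE vw => /(_ isT).
  by have := c'k w ws; case: (c' w).
have inE' u : (u \in V) || (u \in v :: s) -> u != v -> (u \in V) || (u \in s).
  by rewrite inE => + /negPf uv; rewrite uv.
exists (fun u => if u == v then g.+1 else c' u); split.
- by move=> u us; case: eqVneq => [//|uv]; apply/c'k/inE'.
- move=> u w us ws; case: (eqVneq u v) => [->|uv]; case: (eqVneq w v) => [->|wv].
  + by rewrite eI.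
  + by move=> vw; rewrite eq_sym; apply: gP' => //; apply: inE'.
  + by rewrite eS => vu; apply: gP' => //; apply: inE'.
  + by apply: c'P; apply: inE'.
- by move=> u uV; case: eqVneq => [E|_]; [rewrite -E uV in vV | apply: c'V].
Qed.

Lemma sparse_sub (T : finType) (e e' : rel T) : subrel e' e -> sparse e -> sparse e'.
Proof. by move=> s sp g gS ge; apply: sp => // u v /ge/s. Qed.

Lemma sparse_total_extension (T : finType) (e : rel T) (t : nat)
    (VH : {set T}) (eH : rel T) (cv : T -> nat) (ce : T -> T -> nat) :
  sparse e -> 3 <= t -> simple_graph e -> 31 <= maxdeg e + t ->
  subgraph e VH eH -> (forall v, deg eH v <= 1) ->
  total_coloring_in e VH eH (maxdeg e + t) cv ce ->
  exists (cv' : T -> nat) (ce' : T -> T -> nat),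
    [/\ total_coloring_in e [set: T] e (maxdeg e + t) cv' ce',
        (forall v, v \in VH -> cv' v = cv v) &
        (forall u v, eH u v -> ce' u v = ce u v)].
Proof.
move=> eSp t3 [eS eI] k31 [HS He] Hd [cvk cek cvP ceP cvceP].
have [|cv' [cv'k cv'P cv'V]] := @extend_vertex_colouring T e VH (maxdeg e + t) cv eS eI _ cvk cvP.
  by lia.
set k := maxdeg e + t in cek cv'k k31 *.
pose e1 u v := e u v && ~~ eH u v.
have e1S : symmetric e1 by move=> u v; rewrite /e1 eS HS.
have e1e : subrel e1 e by move=> u v /andP[].
pose bad u : {set 'I_k.+1} := [set inord (ce u w) | w in [set w | eH u w]].
(* Among the [k + 1] values of the ordinal type, 0 is not a colour, two are the colours of the ends,
   and at most one per end belongs to an edge of H. This gives the parameter [k - 2]. *)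
pose L u v : {set 'I_k.+1} := ~: ([set ord0; inord (cv' u); inord (cv' v)] :|: (bad u :|: bad v)).
have [| | | |v|u v|u v euv|f [fL fS fP]] :=
  @sparse_list_edge_colouring T 'I_k.+1 ord0 e1 (deg eH) L (k - 2) e1S.
- by move=> v; rewrite /e1 eI.
- exact: sparse_sub eSp.
- by lia.
- exact: Hd.
(* The degrees in [e1] and [eH] add up to at most the maximum degree, which is below [k - 2] because
   [t] is at least 3. *)
- have : deg e1 v + deg eH v <= deg e v.
    rewrite /deg -cardsUI [X in _ + X]eq_card0 ?addn0.
      apply: subset_leq_card; apply/subsetP=> w; rewrite !inE.
      by case/orP=> [/andP[]|/He[]].
    by move=> w; rewrite !inE /e1; case: (eH _ _); rewrite ?andbF.
  by have := deg_le_maxdeg e v; rewrite /k; lia.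
- by rewrite /L [bad v :|: _]setUC; congr (~: (_ :|: _)); rewrite setUAC.
- have badd w : #|bad w| <= deg eH w by apply: leq_imset_card.
  have cardU (A B : {set 'I_k.+1}) := leq_of_leqif (leq_card_setU A B).
  have c3 : #|[set ord0; inord (cv' u); inord (cv' v) : 'I_k.+1]| <= 3.
    by apply: leq_trans (cardU _ _) _; rewrite cards1 cards2; case: (_ != _).
  have := cardsC ([set ord0; inord (cv' u); inord (cv' v)] :|: (bad u :|: bad v)).
  rewrite -/(L u v) card_ord => cL.
  have : k.+1 <= 3 + (deg eH u + deg eH v) + #|L u v|.
    apply: leq_trans (eq_leq (esym cL)) _; rewrite leq_add2r.
    apply: leq_trans (cardU _ _) _; apply: leq_add => //.
    by apply: leq_trans (cardU _ _) _; apply: leq_add; apply: badd.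
  by move: #|L u v| (deg eH u) (deg eH v); clear; lia.
have inordE c : c <= k -> (inord c : 'I_k.+1) = c :> nat by move=> ck; rewrite inordK.
have fL' u v : e1 u v -> [/\ 1 <= f u v <= k, f u v != cv' u :> nat, f u v != cv' v :> nat &
    forall w, eH u w -> f u v != ce u w :> nat].
  move=> euv; have := fL u v euv; rewrite !inE !negb_or => /andP[/andP[/andP[f0 fu] fv] /andP[fbu _]].
  have cvk' w : cv' w <= k by case/andP: (cv'k w).
  split.
  - by rewrite lt0n f0 -ltnS ltn_ord.
  - by apply: contraNneq fu => E; apply/eqP/val_inj; rewrite /= inordE ?E.
  - by apply: contraNneq fv => E; apply/eqP/val_inj; rewrite /= inordE ?E.
  - move=> w uw; apply: contraNneq fbu => E; apply/imsetP; exists w; first by rewrite inE.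
    have [/andP[_ ck] _] := cek u w uw.
    by apply: val_inj; rewrite /= inordE.
have e1N u v : e u v -> eH u v = false -> e1 u v by rewrite /e1 => -> ->.
exists cv', (fun u v => if eH u v then ce u v else f u v); split=> //; last by move=> u v ->.
split=> [v _|u v euv|u v _ _|u v w euv euw vw|u v euv] //; last 1 first.
- case: ifP => uv; last by have [] := fL' u v (e1N _ _ euv uv).
  by have [] := cvceP u v uv; have [_ uV vV] := He u v uv; rewrite !cv'V.
- rewrite [eH v u]HS; case: ifP => uv; first exact: cek.
  by have h := e1N _ _ euv uv; have [] := fL' _ _ h; rewrite (fS _ _ h).
- exact: cv'P.
- case: ifP => uv; case: ifP => uw.
  + exact: ceP uw vw.
  + by have [_ _ _ h] := fL' _ _ (e1N _ _ euw uw); rewrite eq_sym h.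
  + by have [_ _ _ h] := fL' _ _ (e1N _ _ euv uv); rewrite h.
  + by apply: fP; rewrite // e1N.
Qed.

(** * Sparsity of minors of plane maps *)

Section PlaneMap.
Variables (V E F : finType) (e1 e2 : E -> V) (s1 s2 : E -> F).

(** Incidence is taken mod 2: a loop cancels at its vertex, and an edge with the same face on both
    sides separates nothing. *)
Definition incident (x : E) (v : V) := (e1 x == v) (+) (e2 x == v).
Definition separated (A : {set F}) (x : E) := (s1 x \in A) (+) (s2 x \in A).

(** A combinatorial substitute for a map on the sphere: boundaries of sets of faces are cycles mod
    2, one half of Euler's formula holds, and the graph and its dual are connected. *)
Definition plane_map : Prop :=
  [/\ forall v (A : {set F}), \big[addb/false]_x (separated A x && incident x v) = false,
      #|E| + 2 <= #|V| + #|F|,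
      forall S : {set V}, S != set0 -> (forall x, (e1 x \in S) = (e2 x \in S)) -> S = setT &
      forall A : {set F}, A != set0 -> (forall x, ~~ separated A x) -> A = setT].

Hypothesis HP : plane_map.

Variables (U : finType) (r : U -> V).

(* Each nonempty part [l v = Some u] is connected and contains [r u], stated as
   an induction principle. *)
Definition connected_labels (l : V -> option U) :=
  forall S : {set V}, (forall u, r u \in S) ->
    (forall x, l (e1 x) -> l (e1 x) = l (e2 x) -> (e1 x \in S) = (e2 x \in S)) ->
    forall v, l v -> v \in S.

(** By connectivity of the map some edge leaves the labelled region as long as it is not everything;
    its unlabelled end joins the part of the other end. *)
Lemma extend_labels (l : V -> option U) (u0 : U) :
  (forall u, l (r u) = Some u) -> connected_labels l ->
  exists b : V -> U, (forall v u, l v = Some u -> b v = u) /\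
    connected_labels (fun v => Some (b v)).
Proof.
elim: {l}_.+1 {-2}l (ltnSn #|[set v | ~~ l v]|) => // n IHn l len lr lc.
case: (boolP [exists x, l (e1 x) (+) l (e2 x)]) => [/existsP[x lx]|noex]; last first.
  have [_ _ con _] := HP.
  have lT : [set v | isSome (l v)] = setT.
    apply: con; first by apply/set0Pn; exists (r u0); rewrite inE lr.
    move=> x; rewrite !inE; apply/eqP; apply: contraNT noex => h; apply/existsP; exists x.
    by move: h; case: (isSome _); case: (isSome _).
  have lS v : l v by have := in_setT v; rewrite -lT inE.
  exists (fun v => odflt u0 (l v)); split; first by move=> v u ->.
  have lE v : Some (odflt u0 (l v)) = l v by have := lS v; case: (l v).
  move=> S Sr Sc v _; apply: lc => // y ly yy; apply: Sc => //.
  by rewrite !lE.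
have [w [w' [lw lw' ww']]] : exists w w', [/\ isSome (l w), ~~ l w' &
    (e1 x = w /\ e2 x = w') \/ (e1 x = w' /\ e2 x = w)].
  move: lx; case h1: (isSome (l (e1 x))); case h2: (isSome (l (e2 x))) => // _.
    by exists (e1 x), (e2 x); rewrite h1 h2; split; auto.
  by exists (e2 x), (e1 x); rewrite h1 h2; split; auto.
pose l' v := if v == w' then l w else l v.
have l'E v : l v -> l' v = l v by rewrite /l'; case: eqVneq => [-> h|//]; rewrite h in lw'.
have [|||b [bl bc]] := IHn l'.
- apply: leq_trans (len : _ <= n); apply: proper_card; apply/properP; split.
    by apply/subsetP=> v; rewrite !inE; apply: contra => h; rewrite l'E.
  by exists w'; rewrite !inE // /l' eqxx lw.
- by move=> u; rewrite l'E lr.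
- move=> S Sr Sc.
  have lS : forall v, l v -> v \in S.
    apply: lc => // y ly yy; have ly2 : l (e2 y) by rewrite -yy.
    by apply: Sc; rewrite !l'E.
  move=> v; rewrite /l'; case: eqVneq => [-> _|_]; last exact: lS.
  have l'w : l' w = l w by rewrite l'E.
  have l'w' : l' w' = l w by rewrite /l' eqxx.
  have := Sc x; case: ww' => -[-> ->]; rewrite l'w l'w'.
    by move=> <- //; apply: lS.
  by move=> -> //; apply: lS.
exists b; split=> // v u lv; apply: bl; by rewrite l'E lv.
Qed.

(** Membership in the cycle space over the field with two elements. *)
Definition even_edges (D : {set E}) :=
  forall v, \big[addb/false]_(x in D) incident x v = false.

Variable b : V -> U.

(** Trees grow from the roots [r u] inside the parts, one edge for each new vertex. Acyclicity is
    stated as the absence of nonempty even subsets, the form that meets the parity of face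
    boundaries. *)
Lemma spanning_forest : connected_labels (fun v => Some (b v)) ->
  exists T : {set E}, [/\ {in T, forall x, b (e1 x) = b (e2 x)}, #|V| <= #|T| + #|U| &
    forall D : {set E}, D \subset T -> even_edges D -> D = set0].
Proof.
move=> con.
suff ext (S : {set V}) (T : {set E}) :
    (forall u, r u \in S) -> {in T, forall x, b (e1 x) = b (e2 x)} ->
    {in T, forall x, (e1 x \in S) && (e2 x \in S)} -> #|S| <= #|T| + #|U| ->
    (forall D : {set E}, D \subset T -> even_edges D -> D = set0) ->
    exists T : {set E}, [/\ {in T, forall x, b (e1 x) = b (e2 x)}, #|V| <= #|T| + #|U| &
    forall D : {set E}, D \subset T -> even_edges D -> D = set0].
  apply: (ext (r @: U) set0) => [u|x|x||D].
  - exact: imset_f.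
  - by rewrite inE.
  - by rewrite inE.
  - by rewrite cards0 leq_imset_card.
  - by rewrite subset0 => /eqP.
elim: {S}_.+1 {-2}S (ltnSn #|~: S|) T => // n IHn S leSn T Sr Tb TS ST TD.
case: (boolP [exists x, (b (e1 x) == b (e2 x)) && ((e1 x \in S) (+) (e2 x \in S))]); last first.
  move=> noex; have ST' v : v \in S.
    apply: (con S) => // x _ [bx]; move: noex; rewrite negb_exists => /forallP/(_ x).
    by rewrite bx eqxx /=; do 2 case: (_ \in S).
  exists T; split=> //; rewrite -(cardsT V); apply: leq_trans ST; apply: subset_leq_card.
  by apply/subsetP=> v _.
case/existsP=> x /andP[/eqP bx xS].
have [w [wS inc xw]] : exists w, [/\ w \notin S, incident x w &
    forall v, v \in S :|: [set e1 x; e2 x] -> v \in w |: S].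
  move: xS; case h1: (e1 x \in S); case h2: (e2 x \in S) => // _; rewrite /incident.
    exists (e2 x); rewrite h2 eqxx; split=> //.
      by rewrite addbT; apply: contraFneq h2 => <-.
    by move=> v; rewrite !inE => /or3P[->|/eqP->|->]; rewrite ?h1 ?orbT.
  exists (e1 x); rewrite h1 eqxx; split=> //.
    by rewrite addTb; apply: contraFneq h1 => <-.
  by move=> v; rewrite !inE => /or3P[->|->|/eqP->]; rewrite ?h2 ?orbT.
have xT : x \notin T.
  by apply/negP=> /TS/andP[h1 h2]; move: xS; rewrite h1 h2.
have Tw y : y \in T -> incident y w = false.
  move=> /TS/andP[h1 h2]; rewrite /incident.
  by rewrite !(negPf (contraNneq _ wS)) // => <-.
apply: (IHn (w |: S) _ (x |: T)).
- rewrite -ltnS; apply: leq_trans leSn; rewrite ltnS; apply: proper_card; apply/properP; split.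
    by apply/subsetP=> v; rewrite !inE negb_or => /andP[].
  by exists w; rewrite !inE ?wS ?eqxx.
- by move=> u; rewrite inE Sr orbT.
- by move=> y /setU1P[->//|]; apply: Tb.
- move=> y /setU1P[->|/TS/andP[h1 h2]]; first by rewrite !xw // !inE eqxx ?orbT.
  by rewrite !inE h1 h2 !orbT.
- by rewrite !cardsU1 wS xT /= !add1n addSn ltnS.
move=> D DT De; apply: TD => //; apply/subsetP=> y yD.
(* The new vertex [w] is a leaf: [x] is the only edge at [w], so an even set cannot contain it. *)
case/setU1P: (subsetP DT _ yD) => // E0; subst y.
have := De w; rewrite (bigD1 x) //= inc big1 // => y /andP[yD' yx].
by apply: Tw; move: (subsetP DT _ yD'); rewrite !inE (negPf yx).
Qed.

(** Deleting an edge merges the faces on its two sides and so costs at most one class. *)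
Lemma merge_faces (D : seq E) : exists f : F -> F,
  {in D, forall x, f (s1 x) = f (s2 x)} /\ #|F| <= size D + #|[set f z | z : F]|.
Proof.
elim: D => [|x D [f [fD fF]]].
  by exists id; split=> //; rewrite card_imset.
exists (fun z => if f z == f (s1 x) then f (s2 x) else f z); split.
  move=> y; rewrite inE => /predU1P[->|/fD ->//].
  by rewrite eqxx; case: eqVneq.
apply: leq_trans fF _; rewrite /= addSnnS leq_add2l.
rewrite (cardsD1 (f (s1 x))) -add1n; apply: leq_add; first by case: (_ \in _).
apply: subset_leq_card; apply/subsetP=> z; rewrite !inE => /andP[zx /imsetP[y _ zy]].
by apply/imsetP; exists y => //; rewrite -zy (negPf zx).
Qed.

Variable g : rel U.
Hypotheses (gS : symmetric g) (gI : irreflexive g).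

Lemma sum_deg : \sum_u deg g u =
  2 * #|[set p : U * U | g p.1 p.2 && (enum_rank p.1 < enum_rank p.2)]|.
Proof.
have -> : \sum_u deg g u = #|[set p : U * U | g p.1 p.2]|.
  rewrite -sum1dep_card (eq_bigl (fun p : U * U => xpredT p.1 && g p.1 p.2)) //.
  rewrite -(pair_big_dep xpredT (fun u v => g u v) (fun _ _ => 1)) /=.
  by apply: eq_bigr => u _; rewrite sum1dep_card.
rewrite -(cardsID [set p : U * U | enum_rank p.1 < enum_rank p.2]) mul2n -addnn; congr (_ + _).
  by apply: eq_card => p; rewrite !inE.
rewrite -[RHS](@card_imset _ _ (fun p => (p.2, p.1))); last by move=> [? ?] [? ?] [-> ->].
apply: eq_card => -[u v]; rewrite !inE /=; apply/andP/imsetP => [[nlt guv]|[[u' v']]].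
  exists (v, u) => //; rewrite inE /= gS guv /= ltn_neqAle leqNgt nlt andbT.
  apply: contraTneq guv => /val_inj/enum_rank_inj ->; by rewrite gI.
by rewrite inE /= => /andP[guv lt] [-> ->]; rewrite gS guv -leqNgt ltnW.
Qed.

Hypothesis bg : forall u v, g u v -> exists x,
  (b (e1 x) = u /\ b (e2 x) = v) \/ (b (e1 x) = v /\ b (e2 x) = u).

(** With [R] one edge for each edge of [g], [T] contracted, the rest deleted and [K] the face
    classes, Euler's inequality becomes |R| + 2 <= |U| + |K|. Double counting of boundaries gives 3
    |K| <= 2 |R|. *)
Lemma minor_sparse (u0 : U) :
  connected_labels (fun v => Some (b v)) -> \sum_u deg g u < 6 * #|U|.
Proof.
move=> /spanning_forest[T [Tb VT TD]]; have [ev eul _ conF] := HP.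
pose nm x := if enum_rank (b (e1 x)) < enum_rank (b (e2 x))
  then (b (e1 x), b (e2 x)) else (b (e2 x), b (e1 x)).
pose P := [set p : U * U | g p.1 p.2 && (enum_rank p.1 < enum_rank p.2)].
have nmP p : p \in P -> exists x, nm x == p.
  case: p => u v; rewrite inE /= => /andP[guv lt]; have [x bx] := bg guv.
  exists x; rewrite /nm; case: bx => -[-> ->]; first by rewrite lt.
  by rewrite ltnNge ltnW.
pose R := [set x | [exists p in P, [pick x | nm x == p] == Some x]].
have RP x : x \in R -> nm x \in P /\ [pick y | nm y == nm x] = Some x.
  rewrite inE => /exists_inP[p pP /eqP px]; have xp : nm x = p.
    by move: px; case: pickP => // y /eqP yp [<-].
  by rewrite xp.
have nm_inj : {in R &, injective nm}.
  by move=> x y /RP[_ hx] /RP[_ hy] e; apply/Some_inj; rewrite -hx -hy e.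
have cR : #|R| = #|P|.
  rewrite -(card_in_imset nm_inj); apply: eq_card => p; apply/imsetP/idP.
    by case=> x /RP[xP _] ->.
  move=> pP; case Ex: [pick x | nm x == p] => [x|]; last first.
    by have [x xp] := nmP p pP; move: Ex; case: pickP => // /(_ x); rewrite xp.
  exists x; first by rewrite inE; apply/exists_inP; exists p; rewrite ?Ex.
  by move: Ex; case: pickP => // y /eqP yp [<-].
rewrite sum_deg -/P -cR.
have Rb x : x \in R -> b (e1 x) != b (e2 x).
  move=> /RP[+ _]; rewrite inE => /andP[+ _]; rewrite /nm; case: ifP => _ /=; apply: contraTneq => ->;
  by rewrite gI.
have TR : [disjoint T & R].
  by rewrite disjoint_subset; apply/subsetP=> x xT; apply/negP=> /Rb; rewrite Tb // eqxx.
have [f [fD fF]] := merge_faces (enum (~: (T :|: R))).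
have cD : size (enum (~: (T :|: R))) + (#|T| + #|R|) = #|E|.
  rewrite -cardE; have := cardsC (T :|: R); have := leq_card_setU T R => -[_].
  by rewrite TR => /eqP ->; rewrite addnC.
pose K := [set f z | z : F].
pose cl z := [set y | f y == z].
pose bd z := [set x in R | separated (cl z) x].
have bdE z x : (x \in bd z) = (x \in R) && separated (cl z) x by rewrite /bd in_set.
have sepD z x : separated (cl z) x -> x \notin T -> x \in R.
  move=> sx xT; apply: contraTT sx => xR.
  by rewrite /separated !inE fD ?addbb // mem_enum in_setC in_setU negb_or xT xR.
(* The parity of the map is summed over the vertices of part [u]; edges inside the part cancel. *)
have bd_even z u : \big[addb/false]_(x in bd z) ((b (e1 x) == u) (+) (b (e2 x) == u)) = false.
  have E0 : \big[addb/false]_(v | b v == u)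
     \big[addb/false]_x (separated (cl z) x && incident x v) = false.
    by apply: big1 => v _; apply: ev.
  rewrite -[RHS]E0 exchange_big /= [LHS]big_mkcond /=; apply: eq_bigr => x _.
  rewrite -big_distrr /= /incident big_split /= bdE.
  have one w : \big[addb/false]_(v | b v == u) (w == v) = (b w == u).
    case: (boolP (b w == u)) => bw.
      by rewrite (bigD1 w) //= eqxx big1 // => v /andP[_ /negPf]; rewrite eq_sym.
    by apply: big1 => v bv; apply: contraNF bw => /eqP ->.
  rewrite !one; case: (boolP (separated _ _)) => sx; rewrite ?andbF //= andbT.
  case: ifPn => // xR; case: (boolP (x \in T)) => xT; first by rewrite Tb // addbb.
  by case/negP: xR; exact: (sepD z).
(* If no edge of [R] bounded the class, its boundary would be an even subset of the forest, hence
   empty, and by dual connectivity the class would contain all faces. *)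
have bd0 z : 1 < #|K| -> z \in K -> bd z != set0.
  move=> K1 /imsetP[y _ zy]; apply/negP=> /eqP b0.
  have sT : [set x | separated (cl z) x] \subset T.
    apply/subsetP=> x; rewrite inE => sx; apply: contraT => /(sepD z _ sx) xR.
    by have := in_set0 x; rewrite -b0 bdE xR sx.
  have nosep : [set x | separated (cl z) x] = set0.
    apply: TD sT _ => v; rewrite -[RHS](ev v (cl z)) big_mkcond; apply: eq_bigr => x _.
    by rewrite inE; case: ifP.
  have clT : cl z = setT.
    apply: conF => [|x]; first by apply/set0Pn; exists y; rewrite inE zy.
    by have := in_set0 x; rewrite -nosep inE => ->.
  move: K1; suff -> : K = [set z] by rewrite cards1.
  apply/setP=> w; apply/imsetP/set1P => [[y' _ ->]|->]; last by exists y.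
  by have := in_setT y'; rewrite -clT inE => /eqP.
(* By parity another boundary edge continues [x] at each of its two ends; one edge doing both would
   be parallel to [x], but [R] has no parallel edges. *)
have bd3 z : 1 < #|K| -> z \in K -> 2 < #|bd z|.
  move=> K1 zK; have /set0Pn[x xz] := bd0 z K1 zK.
  have other u : (b (e1 x) == u) (+) (b (e2 x) == u) -> exists y, [/\ y \in bd z, y != x &
      (b (e1 y) == u) (+) (b (e2 y) == u)].
    move=> xu; have := bd_even z u; rewrite (bigD1 x) //= xu addTb => /negbFE h.
    case: (boolP [exists y in bd z, (y != x) && ((b (e1 y) == u) (+) (b (e2 y) == u))]).
      by case/exists_inP=> y yz /andP[yx yu]; exists y.
    rewrite negb_exists => /forallP no; move: h; rewrite big1 // => y /andP[yz yx].
    by have := no y; rewrite yz yx /= => /negPf.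
  have xR : x \in R by move: xz; rewrite bdE => /andP[].
  have xb := Rb x xR.
  have [|y [yz yx yu]] := other (b (e1 x)); first by rewrite eqxx addTb eq_sym.
  have [|w [wz wx wu]] := other (b (e2 x)); first by rewrite eqxx addbT.
  have yR : y \in R by move: yz; rewrite bdE => /andP[].
  have yw : y != w.
    apply: contraNneq yx => yw; subst w; apply/eqP/nm_inj => //.
    have {yu wu} : (b (e1 y) = b (e1 x) /\ b (e2 y) = b (e2 x)) \/
        (b (e1 y) = b (e2 x) /\ b (e2 y) = b (e1 x)).
      move: yu wu; case: eqP => h1; case: eqP => h2 //=; rewrite ?h1 ?h2 ?(negPf xb) => _;
        case: eqP => //= h3 _; auto.
    case=> -[E1 E2]; rewrite /nm E1 E2 //; case: ltngtP => // /val_inj/enum_rank_inj e.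
    by rewrite e eqxx in xb.
  have sub3 : [set x; y; w] \subset bd z.
    by apply/subsetP=> v; rewrite !in_setU !in_set1 -orbA => /or3P[]/eqP->.
  apply: leq_trans (subset_leq_card sub3).
  by rewrite -setUA cardsU1 cards2 !inE negb_or yw ![x == _]eq_sym yx wx.
have dc : \sum_(z in K) #|bd z| <= 2 * #|R|.
  rewrite (eq_bigr (fun z => \sum_(x in R) separated (cl z) x)); last first.
    move=> z _; rewrite -sum1_card /bd [RHS]big_mkcond [LHS]big_mkcond; apply: eq_bigr => x _.
    by rewrite in_set; case: (x \in R); case: (separated _ _).
  rewrite exchange_big /= mulnC -sum_nat_const; apply: leq_sum => x _.
  apply: (@leq_trans (\sum_z ((z == f (s1 x)) + (z == f (s2 x))))).
    rewrite big_mkcond; apply: leq_sum => z _; case: ifP => // _.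
    by rewrite /separated !inE ![z == _]eq_sym; do 2 case: eqP.
  have one a : \sum_(z : F) (z == a) = 1.
    by rewrite (bigD1 a) //= eqxx big1 // => z /negPf->.
  by rewrite big_split /= !one.
have U0 : 0 < #|U| by apply/card_gt0P; exists u0.
case: (ltnP 1 #|K|) => K1; last by rewrite -/K in fF; lia.
have : 3 * #|K| <= 2 * #|R|.
  apply: leq_trans dc; rewrite mulnC -sum_nat_const; apply: leq_sum => z zK; exact: bd3.
by rewrite -/K in fF; lia.
Qed.
End PlaneMap.

(** * The square grid as a plane map *)

Section Grid.
Variable N : nat.

Definition gridV : finType := ('I_N.+1 * 'I_N.+1)%type.
Definition gridE : finType := ('I_N * 'I_N.+1 + 'I_N.+1 * 'I_N)%type.
Definition gridF : finType := option ('I_N * 'I_N).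

Definition grid1 (x : gridE) : gridV :=
  match x with inl (i, j) => (inord i, j) | inr (i, j) => (i, inord j) end.
Definition grid2 (x : gridE) : gridV :=
  match x with inl (i, j) => (inord i.+1, j) | inr (i, j) => (i, inord j.+1) end.

(* The square with upper right corner [(a, b)]; squares outside the grid belong
   to the outer face [None]. *)
Definition square (a b : nat) : gridF :=
  if (0 < a) && (0 < b) then
    if insub a.-1 is Some i then
      if insub b.-1 is Some j then Some (i, j) else None
    else None
  else None.

(** [inl] edges are horizontal and [inr] edges vertical; [gridl] is the square below or to the left,
    [gridr] the one above or to the right. *)
Definition gridl (x : gridE) : gridF :=
  match x with inl (i, j) => square i.+1 j | inr (i, j) => square i j.+1 end.
Definition gridr (x : gridE) : gridF :=
  match x with inl (i, j) => square i.+1 j.+1 | inr (i, j) => square i.+1 j.+1 end.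

Lemma square0l b : square 0 b = None. Proof. by []. Qed.
Lemma square0r a : square a 0 = None. Proof. by rewrite /square andbF. Qed.
Lemma squareNl b : square N.+1 b = None.
Proof. by rewrite /square /=; case: ifP => // _; rewrite insubF // ltnn. Qed.
Lemma squareNr a : square a N.+1 = None.
Proof.
rewrite /square /=; case: ifP => // _; case: insub => // i.
by rewrite insubF // ltnn.
Qed.
Lemma squareS (i j : 'I_N) : square i.+1 j.+1 = Some (i, j).
Proof. by rewrite /square /= !valK. Qed.

Lemma addb_at (d : nat -> bool) (y : nat) (n : nat) :
  \big[addb/false]_(i < n) (d i && (i == y :> nat)) = (y < n) && d y.
Proof.
case: ltnP => [yn|ny].
  rewrite (bigD1 (Ordinal yn)) //= eqxx andbT big1 ?addbF // => i iy.
  by rewrite (_ : (i == y :> nat) = false) ?andbF //; apply: contraNF iy.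
by rewrite big1 // => i _; rewrite (_ : (i == y :> nat) = false) ?andbF //; have := ltn_ord i; lia.
Qed.

(** Only the indices [x] and [x - 1] contribute; at either end of the range the missing term is a
    boundary value of [d], which vanishes. *)
Lemma addb_telescope (d : nat -> bool) x : d 0 = false -> d N.+1 = false -> x <= N ->
  \big[addb/false]_(i < N) (d i.+1 && ((i == x :> nat) (+) (i.+1 == x))) = d x (+) d x.+1.
Proof.
move=> d0 dN xN; under eq_bigr do rewrite andb_addr.
rewrite big_split /= (addb_at (fun i => d i.+1)) addbC; congr addb.
  case: x xN => [|x] xN; first by rewrite d0 big1 // => i _; rewrite andbF.
  by under eq_bigr do rewrite eqSS; rewrite (addb_at (fun i => d i.+1)) xN.
by case: ltnP => //= Nx; have -> : x = N by lia.
Qed.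

Lemma inordE m : m <= N -> (inord m : 'I_N.+1) = m :> nat.
Proof. by move=> mN; rewrite inordK. Qed.

Lemma grid_plane_map : plane_map grid1 grid2 gridl gridr.
Proof.
split.
- move=> [x y] A; rewrite big_sumType /=; apply/negP/negP.
  pose chi a b := square a b \in A.
  pose dy a := chi a y (+) chi a y.+1.
  pose dx b := chi x b (+) chi x.+1 b.
  have -> : \big[addb/false]_(i : 'I_N * 'I_N.+1)
      (separated gridl gridr A (inl i) && incident grid1 grid2 (inl i) (x, y)) =
      dy x (+) dy x.+1.
    rewrite -(@addb_telescope dy x); first last.
    + by rewrite -ltnS.
    + by rewrite /dy /chi !squareNl addbb.
    + by rewrite /dy /chi !square0l addbb.
    pose G i j := separated gridl gridr A (inl (i, j)) && incident grid1 grid2 (inl (i, j)) (x, y).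
    rewrite (eq_bigr (fun p => G p.1 p.2)) => [|[] //].
    rewrite -(pair_bigA _ G) /=.
    apply: eq_bigr => i _; rewrite /G /incident /separated /=.
    have := addb_at (fun j => (chi i.+1 j (+) chi i.+1 j.+1) &&
       ((i == x :> nat) (+) (i.+1 == x))) y N.+1.
    rewrite ltn_ord andTb => yE; apply: (etrans _ yE).
    apply: eq_bigr => j _; rewrite -andbA !xpair_eqE; congr (_ && _).
    rewrite -!(inj_eq val_inj) /= !inordE ?(ltnW (ltn_ord i)) //.
    by case: (j == y :> nat); rewrite ?andbT ?andbF.
  have -> : \big[addb/false]_(i : 'I_N.+1 * 'I_N)
      (separated gridl gridr A (inr i) && incident grid1 grid2 (inr i) (x, y)) =
      dx y (+) dx y.+1.
    rewrite -(@addb_telescope dx y); first last.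
    + by rewrite -ltnS.
    + by rewrite /dx /chi !squareNr addbb.
    + by rewrite /dx /chi !square0r addbb.
    pose G i j := separated gridl gridr A (inr (i, j)) && incident grid1 grid2 (inr (i, j)) (x, y).
    rewrite (eq_bigr (fun p => G p.1 p.2)) => [|[] //].
    rewrite -(pair_bigA _ G) /= exchange_big.
    apply: eq_bigr => j _; rewrite /G /incident /separated /=.
    have := addb_at (fun i => (chi i j.+1 (+) chi i.+1 j.+1) &&
       ((j == y :> nat) (+) (j.+1 == y))) x N.+1.
    rewrite ltn_ord andTb => yE; apply: (etrans _ yE).
    apply: eq_bigr => i _; rewrite -andbA !xpair_eqE; congr (_ && _).
    rewrite -!(inj_eq val_inj) /= !inordE ?(ltnW (ltn_ord j)) //.
    by case: (i == x :> nat); rewrite ?andbT ?andbF //= andbC.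
  (* The horizontal and the vertical edges at the vertex both sum [chi] over the same four
     surrounding squares. *)
  rewrite /dx /dy; by case: (chi x y); case: (chi x y.+1); case: (chi x.+1 y); case: (chi x.+1 y.+1).
- rewrite card_sum !card_prod card_option card_prod !card_ord; nia.
- move=> S /set0Pn[[x0 y0] S0] clS.
  have row a b : a <= N -> b <= N -> ((inord a, inord b) \in S) = ((inord 0, inord b) \in S).
    elim: a => // a IHa aN bN; rewrite -IHa //; last exact: ltnW.
    by have := clS (inl (Ordinal aN, inord b)).
  have col b : b <= N -> ((inord 0, inord b) \in S) = ((inord 0, inord 0) \in S).
    elim: b => // b IHb bN; rewrite -IHb //; last exact: ltnW.
    by have := clS (inr (inord 0, Ordinal bN)).
  have all0 v : (v \in S) = ((inord 0, inord 0) \in S).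
    case: v => a b; rewrite -[a]inord_val -[b]inord_val row ?col // -ltnS; exact: ltn_ord.
  by apply/setP=> v; rewrite inE all0 -(all0 (x0, y0)).
- move=> A /set0Pn[z0 A0] clA.
  (* Descending a column of squares leads to the outer face, so the dual is connected. *)
  have row (i : 'I_N) b : b <= N.+1 -> (square i.+1 b \in A) = (None \in A).
    elim: b => [_|b IHb bN]; first by rewrite square0r.
    rewrite -IHb; last exact: ltnW.
    have := clA (inl (i, inord b)); rewrite /separated /= inordE //.
    by do 2 case: (_ \in A).
  have all0 z : (z \in A) = (None \in A).
    by case: z => // -[i j]; rewrite -squareS row // ltnS ltnW.
  by apply/setP=> z; rewrite inE all0 -(all0 z0).
Qed.
End Grid.

(** * Drawings on a grid *)

(** Distance at most [k] in the maximum norm, written without subtraction on naturals. *)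
Definition nigh (k : nat) (a b : nat * nat) :=
  [&& a.1 <= b.1 + k, b.1 <= a.1 + k, a.2 <= b.2 + k & b.2 <= a.2 + k].

Lemma nighC k a b : nigh k a b = nigh k b a.
Proof. by rewrite /nigh; lia. Qed.

Lemma nigh_refl k a : nigh k a a.
Proof. by rewrite /nigh; lia. Qed.

Lemma nigh_add j k a b c : nigh j a b -> nigh k b c -> nigh (j + k) a c.
Proof. by rewrite /nigh; lia. Qed.

Section Cells.
Variable N : nat.

Definition cell (q : gridV N) : nat * nat := (nat_of_ord q.1, nat_of_ord q.2).
Definition at_cell (a : nat * nat) : gridV N := (inord a.1, inord a.2).
Definition in_grid (a : nat * nat) := (a.1 <= N) && (a.2 <= N).

Lemma cellK q : at_cell (cell q) = q.
Proof. by case: q => i j; rewrite /at_cell /cell /= !inord_val. Qed.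

Lemma at_cellK a : in_grid a -> cell (at_cell a) = a.
Proof. by case: a => x y /andP[/= xN yN]; rewrite /cell /= !inordK. Qed.

Lemma in_grid_cell q : in_grid (cell q).
Proof. by apply/andP; split; rewrite -ltnS; apply: ltn_ord. Qed.

Definition adjacent (q q' : gridV N) := exists x : gridE N,
  (grid1 x = q /\ grid2 x = q') \/ (grid1 x = q' /\ grid2 x = q).

Lemma adjacentC q q' : adjacent q q' -> adjacent q' q.
Proof. by case=> x [] [h1 h2]; exists x; [right|left]. Qed.

Lemma adjacent_right a b : a < N -> adjacent (at_cell (a, b)) (at_cell (a.+1, b)).
Proof. by move=> aN; exists (inl (Ordinal aN, inord b)); left. Qed.

Lemma adjacent_up a b : b < N -> adjacent (at_cell (a, b)) (at_cell (a, b.+1)).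
Proof. by move=> bN; exists (inr (inord a, Ordinal bN)); left. Qed.

Definition closed_in (W S : {set gridV N}) := forall q q',
  adjacent q q' -> q \in W -> q' \in W -> q \in S -> q' \in S.

(** The 3 by 3 block around [a], cut off at the border of the grid, is connected: move along the row
    of [a] first, then vertically. *)
Lemma block_subset W S a : closed_in W S -> in_grid a ->
  (forall q, nigh 1 (cell q) a -> q \in W) -> at_cell a \in S ->
  forall q, nigh 1 (cell q) a -> q \in S.
Proof.
move=> cl aN aW aS q qa.
have inW b : in_grid b -> nigh 1 b a -> at_cell b \in W.
  by move=> bN ba; apply: aW; rewrite at_cellK.
have step b b' : in_grid b -> in_grid b' -> nigh 1 b a -> nigh 1 b' a ->
    adjacent (at_cell b) (at_cell b') -> at_cell b \in S -> at_cell b' \in S.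
  by move=> bN b'N ba b'a bb'; apply: cl => //; apply: inW.
rewrite -[q]cellK; move: (in_grid_cell q) qa; move: (cell q) => {q} [x y].
case: a aN aW aS inW step => a b aN aW aS inW step xyN xya.
have xbS : at_cell (x, b) \in S.
  have xbN : in_grid (x, b) by move: aN xyN; rewrite /in_grid /=; lia.
  have xb : nigh 1 (x, b) (a, b) by move: xya; rewrite /nigh /=; lia.
  have [->|[E|E]] : x = a \/ (x = a.+1 \/ a = x.+1) by move: xya; rewrite /nigh /=; lia.
  - by [].
  - apply: step aS => //; first exact: nigh_refl.
    by rewrite E; apply: adjacent_right; move: xbN; rewrite /in_grid /= E; lia.
  - apply: step aS => //; first exact: nigh_refl.
    by rewrite E; apply/adjacentC/adjacent_right; move: aN; rewrite /in_grid /= E; lia.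
have xbN : in_grid (x, b) by move: aN xyN; rewrite /in_grid /=; lia.
have xb : nigh 1 (x, b) (a, b) by move: xya; rewrite /nigh /=; lia.
have [->|[E|E]] : y = b \/ (y = b.+1 \/ b = y.+1) by move: xya; rewrite /nigh /=; lia.
- by [].
- apply: step xbS => //; rewrite E; apply: adjacent_up.
  by move: xyN; rewrite /in_grid /= E; lia.
- apply: step xbS => //; rewrite E; apply/adjacentC/adjacent_up.
  by move: xbN; rewrite /in_grid /= E; lia.
Qed.

(** Each block contains the centre of the next, so the blocks along a walk have a connected
    union. *)
Lemma walk_subset W S (c : nat -> nat * nat) m : closed_in W S ->
  (forall i, i <= m -> in_grid (c i)) ->
  (forall i, i < m -> nigh 1 (c i.+1) (c i)) ->
  (forall i q, i <= m -> nigh 1 (cell q) (c i) -> q \in W) ->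
  at_cell (c 0) \in S ->
  forall i q, i <= m -> nigh 1 (cell q) (c i) -> q \in S.
Proof.
move=> cl cN cs cW c0 i q im.
have : at_cell (c i) \in S.
  elim: i im {q} => // i IHi im; have im' := ltnW im.
  apply: (block_subset cl (cN i im') _ (IHi im')) => [q|]; first exact: cW.
  by rewrite at_cellK ?cN ?cs.
by move=> ci; apply: (block_subset cl (cN i im) _ ci) => q'; exact: cW.
Qed.
End Cells.

(* [c u v i], for [i <= 3 * n], is the cell of the [i]-th sample point on the
   edge from [u] to [v]. *)
Section Discrete.
Variables (U : finType) (e : rel U) (n N : nat) (c : U -> U -> nat -> nat * nat).
Hypotheses (eS : symmetric e) (eI : irreflexive e).
Hypothesis e_dom : forall u, exists v, e u v.
Hypothesis c_start : forall u v w, e u v -> e u w -> c u v 0 = c u w 0.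
Hypothesis c_rev : forall u v i, e u v -> i <= 3 * n -> c u v i = c v u (3 * n - i).
Hypothesis c_step : forall u v i, e u v -> i < 3 * n -> nigh 1 (c u v i.+1) (c u v i).
Hypothesis c_grid : forall u v i, e u v -> i <= 3 * n -> in_grid N (c u v i).
Hypothesis c_ends : forall u v w x i j, e u v -> e w x -> i <= n -> j <= n ->
  nigh 2 (c u v i) (c w x j) -> u = w.
Hypothesis c_mid_end : forall u v w x i j, e u v -> e w x -> n <= i <= 2 * n -> j <= n ->
  nigh 2 (c u v i) (c w x j) -> w = u \/ w = v.
Hypothesis c_mids : forall u v w x i j, e u v -> e w x ->
  n <= i <= 2 * n -> n <= j <= 2 * n ->
  nigh 2 (c u v i) (c w x j) -> (u = w /\ v = x) \/ (u = x /\ v = w).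

Notation gridV := (gridV N).

Definition star u : {set gridV} :=
  [set q | [exists v, e u v && [exists i : 'I_n.+1, nigh 1 (cell q) (c u v i)]]].

Definition middle u v : {set gridV} :=
  [set q | [exists i : 'I_(2 * n).+1, (n <= i) && nigh 1 (cell q) (c u v i)]].

Lemma starP u q : reflect (exists v i, [/\ e u v, i <= n & nigh 1 (cell q) (c u v i)])
  (q \in star u).
Proof.
rewrite inE; apply: (iffP existsP) => [[v /andP[euv /existsP[i h]]]|[v [i [euv im h]]]].
  by exists v, i; rewrite -ltnS ltn_ord.
by exists v; rewrite euv; apply/existsP; exists (Ordinal (im : i < n.+1)).
Qed.

Lemma middleP u v q : reflect (exists i, n <= i <= 2 * n /\ nigh 1 (cell q) (c u v i))
  (q \in middle u v).
Proof.
rewrite inE; apply: (iffP existsP) => [[i /andP[h h']]|[i [/andP[h1 h2] h]]].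
  by exists i; rewrite h -ltnS ltn_ord.
by exists (Ordinal (h2 : i < (2 * n).+1)); rewrite /= h1.
Qed.

(** This is why the separation hypotheses on [c] are stated at distance 2. *)
Lemma nigh2 (q : gridV) a b : nigh 1 (cell q) a -> nigh 1 (cell q) b -> nigh 2 a b.
Proof. by rewrite nighC; exact: nigh_add. Qed.

Lemma star_disjoint u w q : q \in star u -> q \in star w -> u = w.
Proof.
move=> /starP[v [i [uv im qi]]] /starP[x [j [wx jm qj]]].
exact: c_ends uv wx im jm (nigh2 qi qj).
Qed.

Lemma middle_star u v w q : e u v -> q \in middle u v -> q \in star w -> w = u \/ w = v.
Proof.
move=> uv /middleP[i [im qi]] /starP[x [j [wx jm qj]]].
exact: c_mid_end uv wx im jm (nigh2 qi qj).
Qed.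

Lemma middle_middle u v w x q : e u v -> e w x -> q \in middle u v -> q \in middle w x ->
  (u = w /\ v = x) \/ (u = x /\ v = w).
Proof.
move=> uv wx /middleP[i [im qi]] /middleP[j [jm qj]].
exact: c_mids uv wx im jm (nigh2 qi qj).
Qed.

Definition gap u v : {set gridV} := middle u v :\: (star u :|: star v).

Definition adj (q q' : gridV) := [exists x : gridE N,
  ((grid1 x == q) && (grid2 x == q')) || ((grid1 x == q') && (grid2 x == q))].

Lemma adjP q q' : reflect (adjacent q q') (adj q q').
Proof.
apply: (iffP existsP) => -[x h]; exists x.
  by case/orP: h => /andP[/eqP h1 /eqP h2]; [left|right].
by case: h => -[-> ->]; rewrite !eqxx ?orbT.
Qed.

Definition tendril_closed u v (S : {set gridV}) := [forall q, forall q',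
  [&& adj q q', q \in star u :|: S & q' \in gap u v] ==> (q' \in S)].

(* The cells of the middle part of the edge [uv] that can be reached from the
   star of [u] before entering the star of [v]. *)
Definition tendril u v : {set gridV} := \bigcap_(S | tendril_closed u v S) S.

Lemma tendril_gap u v q : q \in tendril u v -> q \in gap u v.
Proof.
move/bigcapP; apply; apply/forallP=> q1; apply/forallP=> q2.
by apply/implyP=> /and3P[].
Qed.

Lemma tendril_step u v q q' : adjacent q q' -> q \in star u :|: tendril u v ->
  q' \in gap u v -> q' \in tendril u v.
Proof.
move=> /adjP qq' qS q'Z; apply/bigcapP=> S Scl.
have /forallP/(_ q)/forallP/(_ q')/implyP := Scl; apply; rewrite qq' q'Z andbT /=.
by move: qS; rewrite !in_setU => /orP[->//|/bigcapP/(_ S Scl)->]; rewrite orbT.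
Qed.

(** Only the end of smaller rank grows along an edge, so tendrils from opposite ends never compete
    for the same middle part. *)
Definition territory u : {set gridV} :=
  star u :|: \bigcup_(v | e u v && (enum_rank u < enum_rank v)) tendril u v.

Lemma territory_star u q : q \in star u -> q \in territory u.
Proof. by rewrite in_setU => ->. Qed.

Lemma territory_tendril u v q : e u v -> enum_rank u < enum_rank v ->
  q \in tendril u v -> q \in territory u.
Proof.
by move=> uv lt qt; rewrite in_setU; apply/orP; right; apply/bigcupP; exists v; rewrite ?uv.
Qed.

Lemma territoryP u q : q \in territory u -> q \in star u \/
  exists v, [/\ e u v, enum_rank u < enum_rank v & q \in tendril u v].
Proof.
by rewrite in_setU => /orP[|/bigcupP[v /andP[uv lt] qt]]; [left|right; exists v].
Qed.

Lemma territory_disjoint u w q : q \in territory u -> q \in territory w -> u = w.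
Proof.
have aux u' v w' : e u' v -> q \in tendril u' v -> q \in star w' -> False.
  move=> uv /tendril_gap; rewrite in_setD => /andP[qn qm] qs.
  by case: (middle_star uv qm qs) => E; subst w'; rewrite in_setU qs ?orbT in qn.
move=> /territoryP[qu|[v [uv luv qu]]] /territoryP[qw|[x [wx lwx qw]]].
- exact: star_disjoint qu qw.
- by case: (aux _ _ _ wx qw qu).
- by case: (aux _ _ _ uv qu qw).
move: (tendril_gap qu) (tendril_gap qw); rewrite !in_setD => /andP[_ qm] /andP[_ qm'].
have [[]//|[E1 E2]] := middle_middle uv wx qm qm'; subst.
by move: luv; rewrite ltnNge ltnW.
Qed.

Definition label q : option U := [pick u | q \in territory u].

Lemma labelE u q : q \in territory u -> label q = Some u.
Proof.
move=> qu; rewrite /label; case: pickP => [w qw|/(_ u)]; last by rewrite qu.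
by congr Some; apply: territory_disjoint qw qu.
Qed.

Lemma label_territory q u : label q = Some u -> q \in territory u.
Proof. by rewrite /label; case: pickP => [w qw [<-]|_ []]. Qed.

Definition first_edge u : U := odflt u [pick v | e u v].

Lemma first_edgeP u : e u (first_edge u).
Proof.
rewrite /first_edge; case: pickP => //= no; have [v uv] := e_dom u.
by rewrite no in uv.
Qed.

Definition centre u : gridV := at_cell N (c u (first_edge u) 0).

Lemma centreE u v : e u v -> centre u = at_cell N (c u v 0).
Proof. by move=> uv; rewrite /centre (c_start (first_edgeP u) uv). Qed.

Lemma centre_star u : centre u \in star u.
Proof.
have uv := first_edgeP u; apply/starP; exists (first_edge u), 0; split=> //.
by rewrite at_cellK ?c_grid // nigh_refl.
Qed.

Lemma label_connected : connected_labels (@grid1 N) (@grid2 N) centre label.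
Proof.
move=> S rS Scl q; case Eq: (label q) => [u|//] _.
have qu := label_territory Eq.
have cl : closed_in (territory u) S.
  move=> q1 q2 [x [[<- <-]|[<- <-]]] /labelE h1 /labelE h2; have := Scl x; rewrite h1 h2.
    by move=> <-.
  by move=> ->.
have starS q' : q' \in star u -> q' \in S.
  move=> /starP[v [i [uv im]]]; apply: (@walk_subset N (territory u) S (c u v) n) => //.
  - by move=> k km; apply: c_grid => //; lia.
  - by move=> k km; apply: c_step => //; lia.
  - move=> k q1 km h; apply: territory_star; apply/starP; by exists v, k.
  - by rewrite -centreE.
case: (territoryP qu) => [|[v [uv luv]]]; first exact: starS.
(* A tendril is the least closed set, so its part inside [S] is everything once it is closed. *)
suff Tcl : tendril_closed u v (S :&: tendril u v).
  by move=> /bigcapP/(_ _ Tcl); rewrite inE => /andP[].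
apply/forallP=> q1; apply/forallP=> q2; apply/implyP=> /and3P[/adjP q12 q1S q2g].
have [q1S' q1t] : q1 \in S /\ q1 \in star u :|: tendril u v.
  move: q1S; rewrite in_setU [q1 \in star u :|: tendril u v]in_setU [q1 \in _ :&: _]in_setI.
  by case/orP=> [h|/andP[-> ->]]; rewrite ?orbT // h starS.
have q2t := tendril_step q12 q1t q2g.
rewrite inE q2t andbT; apply: (cl _ _ q12) => //; last exact: territory_tendril q2t.
move: q1t; rewrite in_setU => /orP[]; [exact: territory_star|exact: territory_tendril].
Qed.

(** Follow the samples of the edge from [u] to [v]. If the star and tendril of [u] never came next
    to the star of [v], they would be closed along this connected strip and would contain the centre
    of [v]. *)
Lemma territories_touch u v : e u v -> enum_rank u < enum_rank v ->
  exists q q', [/\ adjacent q q', q \in territory u & q' \in territory v].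
Proof.
move=> uv luv; have vu : e v u by rewrite eS.
case: (boolP [exists q in star u :|: tendril u v, exists q' in star v, adj q q']).
  case/exists_inP=> q qS /exists_inP[q' q'S /adjP qq']; exists q, q'; split=> //.
    move: qS; rewrite in_setU => /orP[]; [exact: territory_star|exact: territory_tendril].
  exact: territory_star.
move=> no; pose S := star u :|: tendril u v.
pose W := star u :|: middle u v :|: star v.
have cl : closed_in W S.
  move=> q q' qq' _ q'W qS; case: (boolP (q' \in star v)) => q'v.
    case/negP: no; apply/exists_inP; exists q => //; apply/exists_inP; exists q' => //.
    exact/adjP.
  rewrite in_setU; case: (boolP (q' \in star u)) => //= q'u.
  apply: (tendril_step qq') => //; rewrite in_setD in_setU negb_or q'u q'v /=.
  by move: q'W; rewrite !in_setU (negPf q'u) (negPf q'v) orbF.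
have inS : at_cell N (c u v (3 * n)) \in S.
  apply: (@walk_subset N W S (c u v) (3 * n) cl _ _ _ _ (3 * n)) => //.
  - by move=> i im; apply: c_grid.
  - by move=> i im; apply: c_step.
  - move=> i q im h; rewrite !in_setU.
    case: (leqP i n) => i1; first by apply/orP; left; apply/orP; left; apply/starP; exists v, i.
    case: (leqP i (2 * n)) => i2.
      by apply/orP; left; apply/orP; right; apply/middleP; exists i; split=> //; rewrite (ltnW i1).
    apply/orP; right; apply/starP; exists u, (3 * n - i); split=> //; first by lia.
    by rewrite -c_rev.
  - by rewrite -centreE // in_setU centre_star.
  - by rewrite at_cellK ?c_grid // nigh_refl.
have inv : at_cell N (c u v (3 * n)) \in star v.
  by rewrite c_rev // subnn -centreE // centre_star.
move: inS; rewrite in_setU => /orP[h|/tendril_gap].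
  by have E := star_disjoint h inv; rewrite E eI in uv.
by rewrite in_setD in_setU inv orbT.
Qed.

Lemma discrete_drawing_sparse (u0 : U) : \sum_u deg e u < 6 * #|U|.
Proof.
have [|b [bl bc]] := extend_labels (grid_plane_map N) u0 _ label_connected.
  by move=> u; apply/labelE/territory_star/centre_star.
apply: (minor_sparse (grid_plane_map N) eS eI _ u0 bc) => u v uv.
have touch w x : e w x -> enum_rank w < enum_rank x -> exists y : gridE N,
    (b (grid1 y) = w /\ b (grid2 y) = x) \/ (b (grid1 y) = x /\ b (grid2 y) = w).
  move=> wx lt; have [q [q' [[y h] qw q'x]]] := territories_touch wx lt.
  have bq := bl _ _ (labelE qw); have bq' := bl _ _ (labelE q'x).
  by exists y; case: h => -[-> ->]; rewrite bq bq'; [left|right].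
case: (ltngtP (enum_rank u) (enum_rank v)) => [lt|lt|].
- exact: touch.
- by have [|y h] := @touch v u _ lt; [rewrite eS|exists y; case: h; [right|left]].
- by move=> /val_inj/enum_rank_inj E; rewrite E eI in uv.
Qed.
End Discrete.

(** * From plane drawings to grid drawings *)

Section PlaneDrawings.
Import boolp classical_sets reals prodnormedzmodule topology normedtype derive.
Import Order.TTheory GRing.Theory Num.Theory numFieldNormedType.Exports.
Local Open Scope classical_set_scope.
Local Open Scope ring_scope.

(** * Compactness of curves *)

Section Curves.
Variables (R : realType) (V : normedModType R).

Lemma finite_common_radius (I : finType) (P : I -> R -> Prop) :
  (forall i, exists2 d, 0 < d & P i d) ->
  (forall i d d', P i d -> 0 < d' <= d -> P i d') ->
  exists2 d, 0 < d & forall i, P i d.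
Proof.
move=> H mono; have /choice[d dP] : forall i, exists d, 0 < d /\ P i d.
  by move=> i; have [d ? ?] := H i; exists d.
have d0 i : 0 < d i by have [] := dP i.
pose m := \big[Order.min/1]_i d i.
have m0 : 0 < m by apply: (big_ind (fun z => 0 < z)) => // x y x0 y0; rewrite lt_min x0.
exists m => // i; have [_ Pi] := dP i; apply: mono Pi _.
by rewrite m0 /=; exact: bigmin_le.
Qed.

(** The distance attains its minimum on the compact product of the two images. *)
Lemma curve_separation (f g : R -> V) (A B : set R) :
  compact A -> compact B -> {within A, continuous f} -> {within B, continuous g} ->
  (forall s t, A s -> B t -> f s <> g t) ->
  exists2 d, 0 < d & forall s t, A s -> B t -> d <= `|f s - g t|.
Proof.
move=> cA cB cf cg fg.
pose K := (f @` A) `*` (g @` B).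
have [[p Kp]|K0] := pselect (K !=set0); last first.
  exists 1 => // s t As Bt; case: K0; exists (f s, g t).
  by split; [exists s|exists t].
have cK : compact K by apply: compact_setX; apply: continuous_compact.
pose h (q : V * V) : R := `|q.1 - q.2|.
have ch : {within K, continuous h}.
  apply: continuous_subspaceT => q; apply: cvg_norm.
  by apply: cvgB; [exact: cvg_fst|exact: cvg_snd].
have [|[c1 c2]] := compact_EVT_min _ cK ch; first by exists p.
rewrite inE => -[/= [s As sc] [t Bt tc]] cmin; exists (h (c1, c2)).
  rewrite normr_gt0 subr_eq0 /= -sc -tc; apply/eqP; exact: fg.
move=> s' t' As' Bt'; apply: (cmin (f s', g t')); rewrite inE.
by split; [exists s'|exists t'].
Qed.

Lemma curve_unif_continuous (f : R -> V) (A : set R) (eps : R) :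
  compact A -> {within A, continuous f} -> 0 < eps ->
  exists2 d, 0 < d & forall s t, A s -> A t -> `|s - t| < d -> `|f s - f t| < eps.
Proof.
move=> cA /subspace_continuousP cf e0.
have e20 : 0 < eps / 2 by rewrite divr_gt0.
have loc s : A s -> exists2 d, 0 < d & forall t, A t -> `|s - t| < d -> `|f s - f t| < eps / 2.
  move=> As; have := cf s As => /cvgrPdist_lt/(_ _ e20).
  rewrite near_withinE => /nbhs_ballP[d /= d0 dP]; exists d => // t At st.
  by apply: dP.
have /compact_near_coveringP/near_covering_withinP cov := cA.
near (0 : R)^'+ => d; exists d; first by near: d; exact: nbhs_right_gt.
move=> s t As At st; suff : A `<=` (fun s => forall t, A t -> `|s - t| < d -> `|f s - f t| < eps).
  by apply.
near: d; apply: cov => x Ax; have [d d0 dP] := loc x Ax.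
have d20 : 0 < d / 2 by rewrite divr_gt0.
near=> s' d' => As' t At st.
have ss' : `|x - s'| < d / 2 by near: s'; exact: nbhsx_ballx.
have d'd : d' < d / 2 by near: d'; exact: nbhs_right_lt.
have -> : f s' - f t = - (f x - f s') + (f x - f t) by rewrite opprB addrA subrK.
apply: le_lt_trans (ler_normD _ _) _; rewrite normrN [eps]splitr; apply: ltrD.
  by apply: dP => //; lra.
apply: dP => //; have -> : x - t = (x - s') + (s' - t) by rewrite addrA subrK.
apply: le_lt_trans (ler_normD _ _) _; rewrite [d]splitr; apply: ltrD => //.
exact: lt_trans st d'd.
Unshelve. all: by end_near. Qed.
End Curves.

(** * Discretizing a plane drawing *)

Section Drawing.
Variable R : realType.
Let plane : normedModType R := (R * R)%type.

Lemma dist_lt (x y : plane) (d : R) :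
  (`|x - y| < d) = (`|x.1 - y.1| < d) && (`|x.2 - y.2| < d).
Proof. by rewrite prod_normE gt_max. Qed.

Lemma truncn_close1 (x y : R) : 0 <= x -> 0 <= y -> `|x - y| < 1 ->
  (Num.truncn x <= Num.truncn y + 1)%N.
Proof.
move=> x0 y0; rewrite ltr_norml => /andP[_ xy].
have /andP[_ yt] := truncn_itv y0.
by rewrite truncn_le_nat -addn1 !natrD; rewrite -addn1 natrD in yt; lra.
Qed.

Lemma truncn_close2 (x y : R) : 0 <= x -> 0 <= y ->
  (Num.truncn x <= Num.truncn y + 2)%N -> x - y < 3%:R.
Proof.
move=> x0 y0; rewrite truncn_le_nat => xy.
have /andP[yt _] := truncn_itv y0; move: xy; rewrite -addn1 !natrD; lra.
Qed.

Variables (U : finType) (e : rel U) (p : U -> plane) (c : U -> U -> R -> plane).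
Hypotheses (eS : symmetric e) (eI : irreflexive e).
Hypothesis e_dom : forall u, exists v, e u v.
Hypothesis p_inj : injective p.

Let I : set R := [set x : R | 0 <= x <= 1].

Hypothesis c_cont : forall u v, e u v -> {within I, continuous (c u v)}.
Hypothesis c_ends : forall u v, e u v -> c u v 0 = p u /\ c u v 1 = p v.
Hypothesis c_inj : forall u v, e u v -> forall s t : R, 0 <= s <= 1 -> 0 <= t <= 1 ->
  c u v s = c u v t -> s = t.
Hypothesis c_avoid : forall u v, e u v -> forall (s : R) w, 0 < s < 1 -> c u v s <> p w.
Hypothesis c_disjoint : forall u v u' v', e u v -> e u' v' ->
  ~~ (((u == u') && (v == v')) || ((u == v') && (v == u'))) ->
  forall s t : R, 0 < s < 1 -> 0 < t < 1 -> c u v s <> c u' v' t.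

(** The drawing may use unrelated curves for the two directions of an edge; [arc] reads both
    directions off a single one. *)
Let arc u v (s : R) : plane :=
  if (enum_rank u < enum_rank v)%N then c u v s else c v u (1 - s).

Lemma rank_neq u v : e u v -> (enum_rank u < enum_rank v)%N = ~~ (enum_rank v < enum_rank u)%N.
Proof.
move=> uv; rewrite -leqNgt [RHS]leq_eqVlt; case: eqP => //= /ord_inj/enum_rank_inj E.
by rewrite E eI in uv.
Qed.

Lemma arc_rev u v (s : R) : e u v -> arc u v s = arc v u (1 - s).
Proof.
by move=> uv; rewrite /arc (rank_neq uv) opprB addrCA subrr addr0; case: ltnP.
Qed.

Lemma arc0 u v : e u v -> arc u v 0 = p u.
Proof.
move=> uv; have vu : e v u by rewrite eS.
by rewrite /arc subr0; case: ifP => _; [case: (c_ends uv)|case: (c_ends vu)].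
Qed.

Lemma c_meet u v w x (s t : R) : e u v -> e w x ->
  (enum_rank u < enum_rank v)%N -> (enum_rank w < enum_rank x)%N ->
  0 <= s <= 1 -> 0 <= t <= 1 -> c u v s = c w x t ->
  [/\ u = w, v = x & s = t] \/
  exists a b, [/\ (s = 0 /\ a = u) \/ (s = 1 /\ a = v), (t = 0 /\ b = w) \/ (t = 1 /\ b = x) & a = b].
Proof.
move=> uv wx luv lwx sI tI E.
have ends (y : R) : 0 <= y <= 1 -> 0 < y < 1 \/ (y = 0 \/ y = 1).
  move=> /andP[y0 y1]; rewrite !lt_neqAle y0 y1 !andbT.
  by case: (eqVneq 0 y) => [->|_]; [right; left|case: (eqVneq y 1) => [->|_]; [right; right|left]].
have endc u' v' (y : R) : e u' v' -> y = 0 \/ y = 1 -> exists a,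
    ((y = 0 /\ a = u') \/ (y = 1 /\ a = v')) /\ c u' v' y = p a.
  by move=> uv' [->|->]; [exists u'|exists v']; have [h0 h1] := c_ends uv'; split; auto.
case: (ends s sI) => [s01|/(endc _ _ _ uv)[a [sa ca]]];
  case: (ends t tI) => [t01|/(endc _ _ _ wx)[b [tb cb]]].
- case: (boolP (((u == w) && (v == x)) || ((u == x) && (v == w)))) => [|ne].
    case/orP=> /andP[/eqP E1 /eqP E2]; subst; last by move: luv; rewrite ltnNge ltnW.
    by left; split=> //; apply: c_inj E.
  by case: (c_disjoint uv wx ne s01 t01 E).
- by case: (c_avoid uv s01 (etrans E cb)).
- by case: (c_avoid wx t01 (etrans (esym E) ca)).
- by right; exists a, b; split=> //; apply: p_inj; rewrite -ca -cb.
Qed.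

Lemma arc_meet u v w x (s t : R) : e u v -> e w x -> 0 <= s <= 1 -> 0 <= t <= 1 ->
  arc u v s = arc w x t ->
  [\/ [/\ u = w, v = x & s = t], [/\ u = x, v = w & s = 1 - t] |
  exists a b, [/\ (s = 0 /\ a = u) \/ (s = 1 /\ a = v), (t = 0 /\ b = w) \/ (t = 1 /\ b = x) & a = b]].
Proof.
move=> uv wx sI tI.
have vu : e v u by rewrite eS.
have xw : e x w by rewrite eS.
have rI (y : R) : 0 <= y <= 1 -> 0 <= 1 - y <= 1 by move=> ?; lra.
rewrite /arc; case: ifPn => luv; case: ifPn => lwx; rewrite -?rank_neq // in luv lwx.
- by case/c_meet => // h; [constructor 1|constructor 3].
- case/c_meet => // [|[-> -> ->]|[a [b [h1 h2 h3]]]]; [exact: rI|by constructor 2|].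
  by constructor 3; exists a, b; split=> //; case: h2 => -[h2 ->]; [right|left]; split=> //; lra.
- case/c_meet => // [|[-> -> h]|[a [b [h1 h2 h3]]]]; [exact: rI|by constructor 2; split=> //; lra|].
  by constructor 3; exists a, b; split=> //; case: h1 => -[h1 ->]; [right|left]; split=> //; lra.
- case/c_meet => // [||[-> -> h]|[a [b [h1 h2 h3]]]]; [exact: rI|exact: rI|by constructor 1; split=> //; lra|].
  constructor 3; exists a, b; split=> //.
    by case: h1 => -[h1 ->]; [right|left]; split=> //; lra.
  by case: h2 => -[h2 ->]; [right|left]; split=> //; lra.
Qed.

Lemma compact_I (a b : R) : compact [set x : R | a <= x <= b].
Proof.
rewrite (_ : [set x | _] = [set` `[a, b]]); first exact: segment_compact.
by apply/seteqP; split=> x /=; rewrite in_itv.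
Qed.

Lemma arc_unif u v (eps : R) : e u v -> 0 < eps ->
  exists2 d, 0 < d & forall s t : R, 0 <= s <= 1 -> 0 <= t <= 1 -> `|s - t| < d ->
    `|arc u v s - arc u v t| < eps.
Proof.
move=> uv e0; have vu : e v u by rewrite eS.
rewrite /arc; case: (enum_rank u < enum_rank v)%N.
  have [d d0 dP] := curve_unif_continuous (@compact_I 0 1) (c_cont uv) e0.
  by exists d => // s t sI tI st; apply: dP.
have [d d0 dP] := curve_unif_continuous (@compact_I 0 1) (c_cont vu) e0.
exists d => // s t sI tI st; apply: dP => /=; [lra|lra|].
have -> : 1 - s - (1 - t) = t - s by lra.
by rewrite distrC.
Qed.

Lemma arc_cont u v : e u v -> {within I, continuous (arc u v)}.
Proof.
move=> uv; apply/subspace_continuousP => s sI; apply/cvgrPdist_lt => eps e0.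
rewrite near_withinE; have [d d0 dP] := arc_unif uv e0.
by apply/nbhs_ballP; exists d => // t st tI; apply: dP.
Qed.

(** A pair of arcs violating [Q] has disjoint compact pieces, hence a positive distance; there are
    finitely many pairs. *)
Lemma arcs_separated (a b a' b' : R) (Q : U -> U -> U -> U -> Prop) :
  0 <= a -> b <= 1 -> 0 <= a' -> b' <= 1 ->
  (forall u v w x (s t : R), e u v -> e w x -> a <= s <= b -> a' <= t <= b' ->
     arc u v s = arc w x t -> Q u v w x) ->
  exists2 d, 0 < d & forall u v w x (s t : R), e u v -> e w x -> a <= s <= b -> a' <= t <= b' ->
     `|arc u v s - arc w x t| < d -> Q u v w x.
Proof.
move=> a0 b1 a'0 b'1 QP.
pose P (i : (U * U) * (U * U)) (d : R) := forall s t : R, e i.1.1 i.1.2 -> e i.2.1 i.2.2 ->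
  a <= s <= b -> a' <= t <= b' -> `|arc i.1.1 i.1.2 s - arc i.2.1 i.2.2 t| < d ->
  Q i.1.1 i.1.2 i.2.1 i.2.2.
have [||d d0 dP] := @finite_common_radius R _ P.
- move=> [[u v] [w x]]; rewrite /P /=.
  have [q|nq] := pselect (Q u v w x); first by exists 1.
  have [uv|nuv] := boolP (e u v); last by exists 1.
  have [wx|nwx] := boolP (e w x); last by exists 1.
  have sub (y z : R) : 0 <= y -> z <= 1 -> [set r | y <= r <= z] `<=` I.
    by move=> y0 z1 r /= ?; rewrite /I /=; lra.
  have [|||d d0 dP] := @curve_separation R plane (arc u v) (arc w x) _ _
      (@compact_I a b) (@compact_I a' b').
  + exact: continuous_subspaceW (sub _ _ a0 b1) (arc_cont uv).
  + exact: continuous_subspaceW (sub _ _ a'0 b'1) (arc_cont wx).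
  + by move=> s t sab tab E; apply: nq; apply: QP E.
  exists d => // s t _ _ sab tab; rewrite ltNge; by rewrite dP.
- move=> i d d' Pd /andP[d'0 dd'] s t h1 h2 h3 h4 h5.
  by apply: (Pd s t) => //; apply: lt_le_trans h5 dd'.
exists d => // u v w x s t; exact: (dP ((u, v), (w, x))).
Qed.

Lemma arcs_bounded : exists2 M : R, 0 < M & forall u v (s : R), e u v ->
  0 <= s <= 1 -> `|arc u v s| < M.
Proof.
(* Bounds are inverted, so that a common bound becomes a common radius. *)
pose P (i : U * U) (d : R) := forall s : R, e i.1 i.2 -> 0 <= s <= 1 -> `|arc i.1 i.2 s| < d^-1.
have [||d d0 dP] := @finite_common_radius R _ P.
- move=> [u v]; rewrite /P /=; have [uv|nuv] := boolP (e u v); last by exists 1.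
  have /compact_bounded/ex_strict_bound_gt0[M M0 MP] :=
    continuous_compact (arc_cont uv) (@compact_I 0 1).
  exists M^-1; first by rewrite invr_gt0.
  by move=> s _ sI; rewrite invrK; apply: MP; exists s.
- move=> i d d' Pd /andP[d'0 dd'] s h1 h2; apply: lt_le_trans (Pd s h1 h2) _.
  by rewrite lef_pV2 // posrE // (lt_le_trans d'0).
by exists d^-1; [rewrite invr_gt0 | move=> u v s; exact: (dP (u, v))].
Qed.

Lemma arcs_unif (eps : R) : 0 < eps -> exists2 d, 0 < d &
  forall u v (s t : R), e u v -> 0 <= s <= 1 -> 0 <= t <= 1 -> `|s - t| < d ->
    `|arc u v s - arc u v t| < eps.
Proof.
move=> e0; pose P (i : U * U) (d : R) := forall s t : R, e i.1 i.2 ->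
  0 <= s <= 1 -> 0 <= t <= 1 -> `|s - t| < d -> `|arc i.1 i.2 s - arc i.1 i.2 t| < eps.
have [||d d0 dP] := @finite_common_radius R _ P.
- move=> [u v]; rewrite /P /=; have [uv|nuv] := boolP (e u v); last by exists 1.
  by have [d d0 dP] := arc_unif uv e0; exists d => // s t _; apply: dP.
- move=> i d d' Pd /andP[d'0 dd'] s t h1 h2 h3 h4; apply: Pd => //.
  exact: lt_le_trans h4 dd'.
by exists d => // u v s t; exact: (dP (u, v)).
Qed.

Lemma arc_parts : exists2 d : R, 0 < d & forall u v w x (s t : R), e u v -> e w x ->
  `|arc u v s - arc w x t| < d ->
  [/\ 0 <= s <= 1/3 -> 0 <= t <= 1/3 -> u = w,
      1/3 <= s <= 2/3 -> 0 <= t <= 1/3 -> w = u \/ w = v &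
      1/3 <= s <= 2/3 -> 1/3 <= t <= 2/3 -> (u = w /\ v = x) \/ (u = x /\ v = w)].
Proof.
have [|||||d1 d10 sep1] := @arcs_separated 0 (1/3) 0 (1/3) (fun u v w x => u = w); try lra.
  move=> u v w x s t uv wx hs ht.
  case/(arc_meet uv wx); [lra|lra|by case|by case=> _ _ ?; exfalso; lra|].
  by case=> a [b [[[_ ->]|[? _]] [[_ ->]|[? _]]]] //; exfalso; lra.
have [|||||d2 d20 sep2] :=
    @arcs_separated (1/3) (2/3) 0 (1/3) (fun u v w x => w = u \/ w = v); try lra.
  move=> u v w x s t uv wx hs ht.
  case/(arc_meet uv wx); [lra|lra|by case=> ->; left|by case=> _ ->; right|].
  by case=> a [b [[[? _]|[? _]] _ _]]; exfalso; lra.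
have [|||||d3 d30 sep3] := @arcs_separated (1/3) (2/3) (1/3) (2/3)
    (fun u v w x => (u = w /\ v = x) \/ (u = x /\ v = w)); try lra.
  move=> u v w x s t uv wx hs ht.
  case/(arc_meet uv wx); [lra|lra|by case=> -> ->; left|by case=> -> ->; right|].
  by case=> a [b [[[? _]|[? _]] _ _]]; exfalso; lra.
exists (Num.min d1 (Num.min d2 d3)); first by rewrite !lt_min d10 d20 d30.
move=> u v w x s t uv wx; rewrite !lt_min => /and3P[h1 h2 h3].
split=> hs ht; [exact: sep1 h1|exact: sep2 h2|exact: sep3 h3].
Qed.

Lemma drawing_sparse (u0 : U) : (\sum_u deg e u < 6 * #|U|)%N.
Proof.
have [d d0 parts] := arc_parts; have [M M0 bound] := arcs_bounded.
have d30 : 0 < d / 3%:R by rewrite divr_gt0.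
have [eta eta0 unif] := arcs_unif d30.
(* Cells have side d / 3: points less than d / 3 apart lie in cells at distance at most 1, and cells
   at distance at most 2 hold only points less than d apart. Adding [M] makes coordinates
   nonnegative. *)
pose k := 3%:R / d; have k0 : 0 < k by rewrite divr_gt0.
have kd : k * d = 3%:R by rewrite divfK // gt_eqF.
pose cellof (x : plane) := (Num.truncn (k * (x.1 + M)), Num.truncn (k * (x.2 + M))).
(* Consecutive samples differ by 1 / (3 n) < [eta] in parameter. *)
pose n := (Num.truncn eta^-1).+1.
have n3 : 0 < (3 * n)%:R :> R by rewrite ltr0n.
have n_eta : ((3 * n)%:R)^-1 < eta.
  rewrite -[eta]invrK ltf_pV2 ?posrE ?invr_gt0 //.
  apply: lt_le_trans (truncnS_gt _) _; rewrite ler_nat -/n; exact: leq_pmull.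
pose N := Num.truncn (k * (M + M)).
pose par (i : nat) : R := i%:R / (3 * n)%:R.
have par01 i : (i <= 3 * n)%N -> 0 <= par i <= 1.
  by move=> im; rewrite divr_ge0 ?ler0n //= ler_pdivrMr // mul1r ler_nat.
have coord0 (y : R) : `|y| < M -> 0 <= k * (y + M).
  by rewrite ltr_norml => /andP[h _]; rewrite mulr_ge0 ?(ltW k0) //; lra.
have plane_lt (x : plane) : `|x| < M -> `|x.1| < M /\ `|x.2| < M.
  by rewrite -[x]subr0 dist_lt /= !subr0 => /andP[].
have kB (y z : R) : k * (y + M) - k * (z + M) = k * (y - z) by rewrite -mulrBr; congr (_ * _); lra.
have close_cells (x y : plane) : `|x| < M -> `|y| < M -> nigh 2 (cellof x) (cellof y) ->
    `|x - y| < d.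
  move=> /plane_lt[x1 x2] /plane_lt[y1 y2] /and4P[/= h1 h2 h3 h4].
  have half (a b : R) : `|a| < M -> `|b| < M ->
      (Num.truncn (k * (a + M)) <= Num.truncn (k * (b + M)) + 2)%N -> a - b < d.
    move=> /coord0 a0 /coord0 b0 /(truncn_close2 a0 b0).
    by rewrite kB -kd ltr_pM2l.
  rewrite dist_lt !ltr_norml ![- d < _]ltrNl !opprB.
  by rewrite !half.
have cells_close (x y : plane) : `|x| < M -> `|y| < M -> `|x - y| < d / 3%:R ->
    nigh 1 (cellof x) (cellof y).
  move=> /plane_lt[x1 x2] /plane_lt[y1 y2]; rewrite dist_lt => /andP[h1 h2].
  have half (a b : R) : `|a| < M -> `|b| < M -> `|a - b| < d / 3%:R ->
      (Num.truncn (k * (a + M)) <= Num.truncn (k * (b + M)) + 1)%N.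
    move=> /coord0 a0 /coord0 b0 ab; apply: truncn_close1 => //.
    rewrite kB normrM (gtr0_norm k0) -ltr_pdivlMl //.
    by rewrite mulr1 /k invf_div.
  by apply/and4P; split=> /=; apply: half => //; rewrite distrC.
pose cc u v i := cellof (arc u v (par i)).
have third (i : nat) : (i <= n)%N -> 0 <= par i <= 1/3.
  move=> im; rewrite divr_ge0 ?ler0n //= ler_pdivrMr //.
  have : (i%:R : R) <= n%:R by rewrite ler_nat.
  by rewrite natrM; lra.
have middle (i : nat) : (n <= i <= 2 * n)%N -> 1/3 <= par i <= 2/3.
  move=> /andP[h1 h2]; rewrite ler_pdivlMr // ler_pdivrMr //.
  have : (n%:R : R) <= i%:R by rewrite ler_nat.
  have : (i%:R : R) <= (2 * n)%:R by rewrite ler_nat.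
  by rewrite !natrM; lra.
have le3 i : (i <= 2 * n)%N -> (i <= 3 * n)%N.
  by move=> h; apply: leq_trans h _; rewrite leq_mul2r orbT.
have le3' i : (i <= n)%N -> (i <= 3 * n)%N.
  by move=> h; apply: le3; apply: leq_trans h _; exact: leq_pmull.
have arcM u v i : e u v -> (i <= 3 * n)%N -> `|arc u v (par i)| < M.
  by move=> uv im; apply: bound => //; apply: par01.
have cclose u v w x i j : e u v -> e w x -> (i <= 3 * n)%N -> (j <= 3 * n)%N ->
    nigh 2 (cc u v i) (cc w x j) -> `|arc u v (par i) - arc w x (par j)| < d.
  by move=> uv wx im jm; apply: close_cells; apply: arcM.
apply: (@discrete_drawing_sparse U e n N cc) => //.
- by move=> u v w uv uw; rewrite /cc /par mul0r !arc0.
- move=> u v i uv im; rewrite /cc arc_rev //; congr (cellof (arc _ _ _)).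
  by rewrite /par natrB // mulrBl divrr // unitfE gt_eqF.
- move=> u v i uv im; apply: cells_close; [exact: arcM|exact: arcM (ltnW im)|].
  apply: unif; rewrite ?par01 // ?(ltnW im) //.
  by rewrite /par -mulrBl -natrB // subSnn mul1r gtr0_norm ?invr_gt0.
- move=> u v i uv im; have [x1 x2] := plane_lt _ (arcM _ _ _ uv im).
  have half (a : R) : `|a| < M -> (Num.truncn (k * (a + M)) <= N)%N.
    move=> aM; have a0 := coord0 _ aM; rewrite truncn_ge_nat; last by rewrite mulr_ge0 ?(ltW k0) //; lra.
    apply: le_trans (_ : k * (a + M) <= _); first by rewrite truncn_le.
    by rewrite ler_pM2l //; move: aM; rewrite ltr_norml => /andP[_ ?]; lra.
  by rewrite /in_grid /= !half.
- move=> u v w x i j uv wx im jm /(cclose _ _ _ _ _ _ uv wx (le3' _ im) (le3' _ jm)).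
  by move=> /(parts _ _ _ _ _ _ uv wx)[h _ _]; apply: h; apply: third.
- move=> u v w x i j uv wx im jm; have /andP[_ im2] := im.
  move=> /(cclose _ _ _ _ _ _ uv wx (le3 _ im2) (le3' _ jm)).
  by move=> /(parts _ _ _ _ _ _ uv wx)[_ h _]; apply: h; [apply: middle|apply: third].
- move=> u v w x i j uv wx im jm; have /andP[_ im2] := im; have /andP[_ jm2] := jm.
  move=> /(cclose _ _ _ _ _ _ uv wx (le3 _ im2) (le3 _ jm2)).
  by move=> /(parts _ _ _ _ _ _ uv wx)[_ _ h]; apply: h; apply: middle.
Qed.
End Drawing.
End PlaneDrawings.

(** * Sparsity of planar graphs *)

Section PlanarGraphs.
Import Rstruct Rstruct_topology.

Lemma planar_sparse (T : finType) (e : rel T) :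
  symmetric e -> irreflexive e -> planar e -> sparse e.
Proof.
move=> eS eI [p [c [p_inj Hc]]] g gS ge [u0 [v0 g0]].
(* Isolated vertices are dropped, because the centre of a vertex in the grid is read off an incident
   edge. *)
pose U : finType := {v : T | 0 < deg g v}.
pose g' : rel U := fun x y => g (val x) (val y).
have cU : #|U| = #|[set v | 0 < deg g v]| by rewrite card_sig; apply: eq_card => v; rewrite inE.
have degE (x : U) : deg g' x = deg g (val x).
  rewrite /deg -[LHS](card_imset _ val_inj); apply: eq_card => v; rewrite inE.
  apply/imsetP/idP => [[y + ->]|gxv]; first by rewrite inE.
  have v_pos : 0 < deg g v by apply: (@deg_gt0 _ _ _ (val x)); rewrite gS.
  by exists (exist _ v v_pos); rewrite ?inE.
have -> : \sum_v deg g v = \sum_(x : U) deg g' x.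
  rewrite (bigID (fun v => 0 < deg g v)) /= [X in _ + X]big1 ?addn0; last first.
    by move=> v; rewrite -eqn0Ngt => /eqP.
  rewrite (reindex_omap (val : U -> T) insub) => [|v h]; last by rewrite insubT.
  by apply: eq_big => x; rewrite ?degE // (valP x) valK eqxx.
rewrite -cU.
have g'e x y : g' x y -> e (val x) (val y) by apply: ge.
have u0P : 0 < deg g u0 by apply: deg_gt0 g0.
apply: (@drawing_sparse _ U g' (fun x => p (val x)) (fun x y => c (val x) (val y))) (exist _ u0 u0P).
- by move=> x y; apply: gS.
- by move=> x; apply/negP=> /g'e; rewrite eI.
- move=> [u u_pos]; have /card_gt0P[v] := u_pos; rewrite inE => guv.
  have v_pos : 0 < deg g v by apply: (@deg_gt0 _ _ _ u); rewrite gS.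
  by exists (exist _ v v_pos).
- by move=> x y /p_inj/val_inj.
- by move=> x y /g'e/Hc[].
- by move=> x y /g'e/Hc[].
- by move=> x y /g'e/Hc[].
- by move=> x y /g'e/Hc[_ _ _ h _] s w; apply: h.
- move=> x y z w /g'e/Hc[_ _ _ _ h] /g'e zw ne; apply: h zw _.
  by rewrite -!val_eqE in ne.
Qed.
End PlanarGraphs.

Theorem theorem5p1 (T : finType) (e : rel T) (t : nat)
    (VH : {set T}) (eH : rel T) (cv : T -> nat) (ce : T -> T -> nat) :
  3 <= t <= 6 ->
  simple_graph e -> planar e ->
  31 - t <= maxdeg e ->
  subgraph e VH eH ->
  (forall v, deg eH v <= 1) ->
  total_coloring_in e VH eH (maxdeg e + t) cv ce ->
  exists (cv' : T -> nat) (ce' : T -> T -> nat),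
    [/\ total_coloring_in e [set: T] e (maxdeg e + t) cv' ce',
        (forall v, v \in VH -> cv' v = cv v) &
        (forall u v, eH u v -> ce' u v = ce u v)].
Proof.
move=> /andP[t3 t6] [eS eI] pe dt.
apply: sparse_total_extension => //; first exact: planar_sparse.
by rewrite addnC -leq_subLR.
Qed.
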